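(* Let $G$ be a $3$-connected graph with a $3$-connected simple minor $H$. Then $G$ has a forest with $\left\lceil(|G|-|H|+1)/2\right\rceil$ $H$-contractible edges.
   Context: Graphs are allowed to have loops and parallel edges; $|G|$ denotes the number of vertices of $G$. A graph is $k$-connected if the removal of each set of fewer than $k$ vertices leaves a connected graph (the usual requirement that $|G|>k$ is not imposed). An $H$-minor of a graph is a minor isomorphic to $H$. If $G$ is a $3$-connected graph with a simple $H$-minor, an edge $e$ of $G$ is $H$-contractible if $G/e$ (the graph obtained from $G$ by contracting $e$) is $3$-connected with an $H$-minor. The conclusion means that $G$ has a forest as a subgraph with the stated number of edges, all of them $H$-contractible edges of $G$.
   Formalization: The formal theorem assumes |H| < |G| and that H has at least one vertex; for |G| = |H| (e.g. G = H = K_4) the formula asks for one edge, but contracting a non-loop edge leaves fewer than |H| vertices, so the claim is false there. *)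

(* Defs.v *)
From mathcomp Require Import all_boot.

Set Implicit Arguments.
Unset Strict Implicit.
Unset Printing Implicit Defensive.

(* Finite undirected multigraphs.  The order of the two ends of an edge is
   only a presentation: [ends], hence [adj], [iso] and all notions below,
   ignore it.  The empty graph is allowed, so that every vertex set can be
   removed. *)
Record mgraph := MGraph {
  vert : finType;
  edge : finType;
  src : edge -> vert;
  tgt : edge -> vert
}.

Definition ends (G : mgraph) (e : edge G) : {set vert G} := [set src e; tgt e].

Definition simple (G : mgraph) : Prop :=
  (forall e : edge G, src e != tgt e) /\ injective (@ends G).

Definition iso (G H : mgraph) : Prop :=
  exists (fv : vert G -> vert H) (fe : edge G -> edge H),
    [/\ bijective fv, bijective fe &
        forall e : edge G, ends (fe e) = fv @: ends e].

Section Operations.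
Variable G : mgraph.

Section DeleteVertices.
Variable X : {set vert G}.

Definition dv_edge (e : edge G) : bool := (src e \notin X) && (tgt e \notin X).

Lemma dv_src (e : {e : edge G | dv_edge e}) : src (val e) \notin X.
Proof. by case/andP: (valP e). Qed.

Lemma dv_tgt (e : {e : edge G | dv_edge e}) : tgt (val e) \notin X.
Proof. by case/andP: (valP e). Qed.

Definition del_verts : mgraph :=
  @MGraph {x : vert G | x \notin X} {e : edge G | dv_edge e}
    (fun e => exist _ (src (val e)) (dv_src e))
    (fun e => exist _ (tgt (val e)) (dv_tgt e)).

End DeleteVertices.

(* The spanning subgraph with edge set F. *)
Definition edge_subgraph (F : {set edge G}) : mgraph :=
  @MGraph (vert G) {e : edge G | e \in F}
    (fun e => src (val e)) (fun e => tgt (val e)).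

Section Contract.
Variable e : edge G.

(* The vertex [tgt e] is merged into [src e]; when e is a loop no vertex
   disappears and G/e is G with e deleted.  Edges parallel to e become loops. *)
Definition ct_vert (x : vert G) : bool := (x == src e) || (x != tgt e).

Definition ct_map (x : vert G) : vert G := if x == tgt e then src e else x.

Lemma ct_mapP (x : vert G) : ct_vert (ct_map x).
Proof.
rewrite /ct_vert /ct_map; case: (altP (x =P tgt e)) => [_|->].
  by rewrite eqxx.
by rewrite orbT.
Qed.

Definition contract : mgraph :=
  @MGraph {x : vert G | ct_vert x} {f : edge G | f != e}
    (fun f => exist _ (ct_map (src (val f))) (ct_mapP _))
    (fun f => exist _ (ct_map (tgt (val f))) (ct_mapP _)).

End Contract.
End Operations.

(* [minor M G]: M arises from G by deleting vertices, deleting edges and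
   contracting edges. *)
Inductive minor (M : mgraph) : mgraph -> Prop :=
| minor_refl : minor M M
| minor_del_vert (G : mgraph) (x : vert G) :
    minor M (del_verts [set x]) -> minor M G
| minor_del_edge (G : mgraph) (e : edge G) :
    minor M (edge_subgraph [set~ e]) -> minor M G
| minor_contract (G : mgraph) (e : edge G) :
    minor M (contract e) -> minor M G.

Definition has_minor (G H : mgraph) : Prop :=
  exists M : mgraph, minor M G /\ iso M H.

Definition adj (G : mgraph) : rel (vert G) :=
  fun x y => [exists e : edge G, ends e == [set x; y]].

(* The empty graph counts as connected, so that K_1 and K_2 are 3-connected. *)
Definition connected (G : mgraph) : Prop :=
  forall x y : vert G, connect (@adj G) x y.

Definition k_connected (k : nat) (G : mgraph) : Prop :=
  forall X : {set vert G}, #|X| < k -> connected (del_verts X).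

(* The vertices vs = v_0 .. v_(n-1) and edges es = e_0 .. e_(n-1) form a cycle
   of length n > 0, with e_i joining v_i and v_(i+1 mod n).  A loop is a cycle
   of length 1 and a pair of parallel edges a cycle of length 2. *)
Definition is_cycle (G : mgraph) (vs : seq (vert G)) (es : seq (edge G)) :
    Prop :=
  [/\ vs != [::], uniq vs, uniq es &
      map (@ends G) es = [seq [set p.1; p.2] | p <- zip vs (rot 1 vs)]].

Definition forest (G : mgraph) : Prop :=
  forall (vs : seq (vert G)) (es : seq (edge G)), ~ is_cycle vs es.

Definition H_contractible (H G : mgraph) (e : edge G) : Prop :=
  k_connected 3 (contract e) /\ has_minor (contract e) H.

(* Main.v *)
Require Import Defs.
From mathcomp Require Import all_boot zify.

Set Implicit Arguments.
Unset Strict Implicit.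
Unset Printing Implicit Defensive.

(**
Let K be the graph on V(G) formed by the H-contractible edges; it suffices to
show that K has at most (|G| + |H| - 1) / 2 components, by induction on |G|.
If fewer than |H| vertices are isolated in K, this holds because every other
component has at least two vertices.  Otherwise some vertex u isolated in K has
an edge inside a branch set of an H-model.  That edge lies in a 3-cut, one side
of which is not needed for H since H is 3-connected; uncrossing minimal such
sides yields a triangle u p q with p and q of degree 3 whose contraction keeps
an H-minor.  If y and w are the outer neighbours of p and q, then y p q w is a
path of K, which settles the case |G| <= |H| + 5.  If G/upq is 3-connected,
then every edge of K(G/upq) except possibly y w lifts to K, and y and w are
already joined in K; so the bound for G/upq plus the isolated vertex u is
enough.  If no such triangle at u has a 3-connected contraction, every edge of
K(G/pq) lifts to K, and the bound for G/pq is enough.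
*)

(** * Vertex cuts *)

(** If K has c components, a spanning forest of K has |G| - c edges, so bounding c is enough; a
    dominating set of K stands in for one vertex per component. The obstacle in the induction is
    that K(G/S) need not lift to K. For a clique S, an edge a b of G that is contractible in G/S can
    fail in G only if a and b lie in a 3-cut one side of which is contained in S, since any other
    3-cut around a b survives in G/S. With S = {p, q} that side is p or q alone, so a b joins two
    neighbours of a cubic vertex, and the only dangerous edges are those from u to the triangle or
    to an outer neighbour. If such an edge is contractible in G/pq, then u lies in a triangle with
    two cubic vertices whose contraction is 3-connected; hence the case distinction. The balance is
    tight when a triangle is contracted: two vertices disappear and u costs one component. The
    constant 5 comes from the path y p q w: it leaves at most |G| - 3 components, and 2(|G| - 3) + 1
    <= |G| + |H| says |G| <= |H| + 5. *)

Section Cuts.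
Variables (V : finType) (g : rel V).

(* Locked, so that [inE] does not unfold them. *)
Definition nbh (A : {set V}) : {set V} :=
  locked [set y | (y \notin A) && [exists x in A, g x y]].

Definition far (A : {set V}) : {set V} := locked (~: (A :|: nbh A)).

(* 3-connectedness, without a lower bound on the order. *)
Definition con3 : Prop :=
  forall A : {set V}, A != set0 -> far A != set0 -> 2 < #|nbh A|.

Definition sep3 (A : {set V}) : Prop :=
  [/\ A != set0, far A != set0 & #|nbh A| = 3].

Lemma nbhP (A : {set V}) (y : V) :
  reflect (y \notin A /\ exists2 x, x \in A & g x y) (y \in nbh A).
Proof.
rewrite /nbh -lock inE; apply: (iffP andP) => -[yA].
  by move/exists_inP => [x xA xy]; split=> //; exists x.
by case=> x xA xy; split=> //; apply/exists_inP; exists x.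
Qed.

Lemma mem_nbh (A : {set V}) (x y : V) :
  x \in A -> g x y -> y \notin A -> y \in nbh A.
Proof. by move=> xA xy yA; apply/nbhP; split=> //; exists x. Qed.

Lemma nbh_notin (A : {set V}) (y : V) : y \in nbh A -> y \notin A.
Proof. by case/nbhP. Qed.

Lemma in_far (A : {set V}) (y : V) :
  (y \in far A) = (y \notin A) && (y \notin nbh A).
Proof. by rewrite /far -lock in_setC in_setU negb_or. Qed.

Lemma sideP (A : {set V}) (y : V) :
  [\/ [/\ y \in A, y \notin nbh A & y \notin far A],
      [/\ y \notin A, y \in nbh A & y \notin far A] |
      [/\ y \notin A, y \notin nbh A & y \in far A]].
Proof.
rewrite in_far; case: (boolP (y \in nbh A)) => yN.
  by rewrite (nbh_notin yN); apply: Or32.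
by case: (boolP (y \in A)) => yA; [apply: Or31 | apply: Or33].
Qed.

Lemma far_edge (A : {set V}) (x y : V) : x \in A -> y \in far A -> g x y = false.
Proof.
rewrite in_far => xA /andP[yA]; apply: contraNF => xy.
exact: mem_nbh xA xy yA.
Qed.

(** The corner of two crossing cuts. Naming the three pieces that hold its neighbours, rather than
    counting them, lets [uncross] bound each corner by explicit vertices. *)
Lemma nbh_setI (A B : {set V}) :
  nbh (A :&: B) \subset (nbh A :&: B) :|: (A :&: nbh B) :|: (nbh A :&: nbh B).
Proof.
apply/subsetP => y /nbhP[yAB [x /setIP[xA xB] xy]].
have yA : (y \in A) || (y \in nbh A).
  by case: (boolP (y \in A)) => //= yA; apply: mem_nbh xA xy yA.
have yB : (y \in B) || (y \in nbh B).
  by case: (boolP (y \in B)) => //= yB; apply: mem_nbh xB xy yB.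
move: yAB yA yB; rewrite !in_setU !in_setI.
by case: (y \in A); case: (y \in B); case: (y \in nbh A); case: (y \in nbh B).
Qed.

Hypothesis g_sym : symmetric g.
Hypothesis g_con3 : con3.

Lemma far_sub (A B : {set V}) : A \subset B -> far B \subset far A.
Proof.
move=> AB; apply/subsetP => y; rewrite !in_far => /andP[yB yN].
rewrite (contra (subsetP AB y)) //=; apply: contra yN => /nbhP[_ [x xA xy]].
exact: mem_nbh (subsetP AB x xA) xy yB.
Qed.

Lemma sub_far (A B : {set V}) : A \subset far B -> B \subset far A.
Proof.
move=> AB; apply/subsetP => y yB; rewrite in_far.
have yA : y \notin A.
  by apply/negP => /(subsetP AB); rewrite in_far yB.
rewrite yA /=; apply/negP => /nbhP[_ [x /(subsetP AB) xB xy]].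
by move: xy; rewrite g_sym (far_edge yB xB).
Qed.

Lemma far_farE (A : {set V}) : A \subset far (far A).
Proof. exact: sub_far. Qed.

Lemma nbh_far (A : {set V}) : nbh (far A) \subset nbh A.
Proof.
apply/subsetP => y /nbhP[yF [x xF xy]].
case: (sideP A y) => -[] // yA _; last by rewrite (negPf yF).
move=> _.
by move: xy; rewrite g_sym (far_edge yA xF).
Qed.

Lemma far_big (A B : {set V}) :
  A != set0 -> B != set0 -> B \subset far A -> 2 < #|nbh A|.
Proof.
move=> A0 B0 BA; apply: g_con3 => //; apply: contra_neq B0 => A1.
by apply/eqP; rewrite -subset0 -A1.
Qed.

(** A nonempty [A] would inherit a nonempty far side from [D] and so have three neighbours. The
    vertices [a] and [b] may coincide, which encodes a single neighbour. *)
Lemma small_set0 (A D : {set V}) (a b : V) :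
  far D != set0 -> A \subset D -> nbh A \subset [set a; b] -> A = set0.
Proof.
move=> D0 AD sub; apply/eqP; apply: contraTT (subset_leq_card sub) => A0.
rewrite -ltnNge; apply: leq_ltn_trans (far_big A0 D0 (far_sub AD)).
by rewrite cards2; case: eqP.
Qed.

(** The far side has no neighbours outside [nbh A], and 3-connectedness forces it to have all three.
    Hence the two sides of a 3-cut are interchangeable. *)
Lemma sep3_far (A : {set V}) : sep3 A ->
  [/\ sep3 (far A), nbh (far A) = nbh A & far (far A) = A].
Proof.
move=> [A0 F0 N3].
have F3 : 2 < #|nbh (far A)|.
  by apply: far_big (far_farE A).
have FN : nbh (far A) = nbh A by apply/eqP; rewrite eqEcard nbh_far N3.
have FF : far (far A) = A.
  apply/setP => y; rewrite in_far FN in_far negb_and !negbK.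
  by case: (boolP (y \in nbh A)) => [/nbh_notin/negPf->|_]; rewrite ?andbF ?orbF ?andbT.
by split=> //; split; rewrite ?FF ?FN.
Qed.

Lemma nbh_side (A : {set V}) (y : V) : sep3 A -> y \in nbh A ->
  (exists2 x, x \in A & g y x) /\ (exists2 x, x \in far A & g y x).
Proof.
move=> sA yN; have [_ FN _] := sep3_far sA; split.
  by case/nbhP: yN => _ [x xA]; rewrite g_sym => yx; exists x.
by move: yN; rewrite -FN => /nbhP[_ [x xA]]; rewrite g_sym => yx; exists x.
Qed.

Lemma set3_card (A : {set V}) (a b c : V) : #|A| = 3 -> A = [set a; b; c] ->
  [/\ a != b, a != c & b != c].
Proof.
move=> A3 AE; move: A3; rewrite AE -setUA cardsU1 cards2 !inE.
by do 3!case: eqP => //=.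
Qed.

Lemma set3E (A : {set V}) (a b : V) : #|A| = 3 -> a \in A -> b \in A -> a != b ->
  exists c, A = [set a; b; c].
Proof.
move=> A3 aA bA ab.
have : #|A :\ a :\ b| == 1.
  have := cardsD1 b (A :\ a); have := cardsD1 a A.
  by rewrite aA A3 !inE eq_sym ab bA /=; lia.
case/cards1P => c cE; exists c; apply/setP => x; move/setP/(_ x): cE; rewrite !inE.
have [->|xa] := eqVneq x a; first by rewrite aA.
by have [->|xb] := eqVneq x b; rewrite ?bA //=.
Qed.

Lemma set3E1 (A : {set V}) (a : V) : #|A| = 3 -> a \in A ->
  exists b c, A = [set a; b; c].
Proof.
move=> A3 aA; have : 0 < #|A :\ a|.
  by have := cardsD1 a A; rewrite aA A3; lia.
rewrite card_gt0 => /set0Pn[b /setD1P[ba bA]].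
have [|c cE] := set3E A3 aA bA; first by rewrite eq_sym.
by exists b, c.
Qed.

(** The third vertex t' of [nbh C] decides. If t' is in [far D], then [D] meets [nbh C] only in [p],
    and [w], [t] lie on different sides of [C]: otherwise the opposite side would split into two
    corners with at most two neighbours each and be empty. If t' is not in [far D], no vertex of
    [nbh C] is, and some side of [C] lies inside [D]. *)
Lemma uncross (C D : {set V}) (u w t p : V) :
  sep3 C -> sep3 D -> nbh D = [set u; w; t] -> u \in nbh C -> p \in nbh C ->
  p \in D ->
  exists2 C1, C1 = C \/ C1 = far C &
    C1 \subset D \/
    [/\ w \in C1, t \in far C1, nbh (D :&: C1) \subset [set u; p; w],
        nbh (D :&: far C1) \subset [set u; p; t] & D :&: nbh C = [set p]].
Proof.
move=> sC sD ND uC pC pD.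
have [sC' NC' FC'] := sep3_far sC; have [sD' ND' FD'] := sep3_far sD.
have [C0 F0 C3] := sC; have [D0 G0 D3] := sD.
have [uw ut wt] := set3_card D3 ND.
have uD : u \in nbh D by rewrite ND !inE eqxx.
have up : u != p by apply: contraTneq pD => <-; apply: nbh_notin.
have [t' NC] := set3E C3 uC pC up.
have [_ ut' pt'] := set3_card C3 NC.
have uDn : u \notin D := nbh_notin uD.
have [t'F|t'F] := boolP (t' \in far D).
  have Z x : x \in D -> x \in nbh C -> x = p.
    move=> xD; rewrite NC !inE -orbA => /or3P[]/eqP // E.
      by rewrite -E xD in uDn.
    by move: t'F; rewrite in_far -E xD.
  have Dp : D :&: nbh C = [set p].
    apply/setP => x; rewrite in_setI in_set1; apply/andP/eqP => [[]|->] //.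
    exact: Z.
  have wtC : forall x, (x == w) || (x == t) -> x \notin nbh C.
    move=> x xwt; have xN : x \in nbh D by rewrite ND !inE; case/orP: xwt => ->;
      rewrite ?orbT.
    rewrite NC !inE; apply/negP; rewrite -orbA => /or3P[]/eqP E.
    - by move: xwt; rewrite E (negPf uw) (negPf ut).
    - by move: (nbh_notin xN); rewrite E pD.
    by move: t'F; rewrite -E in_far xN andbF.
  have same C1 : sep3 C1 -> nbh C1 = nbh C -> w \in far C1 -> t \in far C1 -> False.
    move=> sC1 NC1 wF tF.
    have X x : x \in nbh D -> x \in C1 -> False.
      rewrite ND !inE -orbA => /or3P[]/eqP-> xC1.
      - by have := @nbh_notin C1 u; rewrite NC1 uC xC1 => /(_ isT).
      - by move: wF; rewrite in_far xC1.
      by move: tF; rewrite in_far xC1.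
    have E1 : D :&: C1 = set0.
      apply: (@small_set0 _ D u p) => //; first exact: subsetIl.
      apply: subset_trans (nbh_setI _ _) _; apply/subsetP => x;
        rewrite !in_setU !in_setI NC1.
      rewrite -orbA => /or3P[]/andP[x1 x2].
      - by case: (X x).
      - by rewrite (Z x) // !inE eqxx orbT.
      move: x2; rewrite NC !inE => /orP[->//|/eqP E].
      by move: t'F; rewrite in_far -E x1 andbF.
    have E2 : far D :&: C1 = set0.
      apply: (@small_set0 _ (far D) u t'); first by rewrite FD'.
        exact: subsetIl.
      apply: subset_trans (nbh_setI _ _) _; apply/subsetP => x;
        rewrite !in_setU !in_setI NC1 ND'.
      rewrite -orbA => /or3P[]/andP[x1 x2].
      - by case: (X x).
      - move: x2; rewrite NC !inE => /orP[/orP[->//|/eqP E]|->]; rewrite ?orbT //.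
        by move: x1; rewrite E in_far pD.
      move: x2; rewrite NC !inE => /orP[/orP[->//|/eqP E]|->]; rewrite ?orbT //.
      by move: (nbh_notin x1); rewrite E pD.
    case: sC1 => /set0Pn[x xC1] _ _.
    case: (sideP D x) => -[xD xN xF].
    - by move/setP/(_ x): E1; rewrite !inE xD xC1.
    - exact: X xN xC1.
    by move/setP/(_ x): E2; rewrite in_setI xF xC1 inE.
  have split C1 : sep3 C1 -> nbh C1 = nbh C -> w \in C1 -> t \in far C1 ->
    [/\ w \in C1, t \in far C1, nbh (D :&: C1) \subset [set u; p; w],
        nbh (D :&: far C1) \subset [set u; p; t] & D :&: nbh C = [set p]].
    move=> sC1 NC1 wC tF; have [sC2 NC2 FC2] := sep3_far sC1.
    have tC : t \notin C1 by move: tF; rewrite in_far => /andP[].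
    have wF : w \notin far C1 by rewrite in_far wC.
    have Y x : x \in nbh D -> x \in nbh C -> x = u.
      rewrite ND !inE -orbA => /or3P[]/eqP// -> xN.
        by move: xN; rewrite (negPf (wtC w _)) ?eqxx.
      by move: xN; rewrite (negPf (wtC t _)) ?eqxx ?orbT.
    split=> //; apply: subset_trans (nbh_setI _ _) _; apply/subsetP => x;
      rewrite !in_setU !in_setI ?NC2 NC1 -orbA => /or3P[]/andP[x1 x2].
    - move: x1; rewrite ND !inE => /orP[/orP[->|->]|/eqP E]; rewrite ?orbT //.
      by rewrite -E x2 in tC.
    - by rewrite (Z x) // !inE eqxx orbT.
    - by rewrite (Y x) // !inE eqxx.
    - move: x1; rewrite ND !inE => /orP[/orP[->//|/eqP E]|->]; rewrite ?orbT //.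
      by rewrite -E x2 in wF.
    - by rewrite (Z x) // !inE eqxx orbT.
    by rewrite (Y x) // !inE eqxx.
  have wN : w \notin nbh C by apply: wtC; rewrite eqxx.
  have tN : t \notin nbh C by apply: wtC; rewrite eqxx orbT.
  case: (sideP C w) => -[w1 w2 w3]; rewrite ?w2 // in wN;
  case: (sideP C t) => -[t1 t2 t3]; rewrite ?t2 // in tN.
  - by case: (same (far C)); rewrite ?FC'.
  - by exists C; [left | right; apply: split].
  - exists (far C); [by right | right; apply: split; rewrite ?FC' //].
  by case: (same C).
(* As [nbh C1] misses [far D], all neighbours of this corner are in [nbh D]; the vertex [z] beyond
   [C1] is not one of them, so at most two remain. *)
have key C1 : sep3 C1 -> nbh C1 = nbh C -> nbh D :&: far C1 != set0 ->
    far D :&: C1 = set0.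
  move=> sC1 NC1 /set0Pn[z /setIP[zN zF]].
  have zC1 : z \notin nbh C1 by move: zF; rewrite in_far => /andP[].
  have [a [b sab]] : exists a b, nbh D :\ z \subset [set a; b].
    have [a [b E]] := set3E1 D3 zN.
    by exists a, b; rewrite E; apply/subsetP => x; rewrite !inE; case: (x == z).
  apply: (@small_set0 _ (far D) a b); first by rewrite FD'.
    exact: subsetIl.
  apply: subset_trans sab; apply: subset_trans (nbh_setI _ _) _.
  apply/subsetP => x; rewrite !in_setU !in_setI ND' => H; rewrite in_setD1.
  have nz : x != z.
    case/orP: H => [/orP[]|] /andP[x1 x2]; last by apply: contraNneq zC1 => <-.
      by apply: contraTneq zF => <-; rewrite in_far x2.
    by apply: contraNneq zC1 => <-.
  rewrite nz; case/orP: H => [/orP[]|] /andP[x1 x2] //=.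
  move: x2; rewrite NC1 NC !inE -orbA => /or3P[]/eqP E.
  + by rewrite E.
  + by move: x1; rewrite E in_far pD.
  by rewrite E (negPf t'F) in x1.
have sub C1 : sep3 C1 -> nbh C1 = nbh C -> nbh D :&: C1 = set0 ->
    nbh D :&: far C1 != set0 -> C1 \subset D.
  move=> sC1 NC1 E0 /(key _ sC1 NC1) E2.
  apply/subsetP => x xC1; case: (sideP D x) => -[] // xD xN xF.
    by move/setP/(_ x): E0; rewrite in_setI xN xC1 inE.
  by move/setP/(_ x): E2; rewrite in_setI xF xC1 inE.
have [E1|N1] := eqVneq (nbh D :&: C) set0.
  have [E2|N2] := eqVneq (nbh D :&: far C) set0; last first.
    by exists C; [left | left; apply: sub].
  have X x : x \in nbh D -> x \in nbh C.
    move=> xD; case: (sideP C x) => -[] // x1 x2 x3.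
      by move/setP/(_ x): E1; rewrite in_setI xD x1 inE.
    by move/setP/(_ x): E2; rewrite in_setI xD x3 inE.
  have Y x : x \in nbh D -> x != u -> x = t'.
    move=> xD xu; have := X x xD; rewrite NC !inE (negPf xu) => /orP[]/eqP // E.
    by move: (nbh_notin xD); rewrite E pD.
  have wD : w \in nbh D by rewrite ND !inE eqxx orbT.
  have tD : t \in nbh D by rewrite ND !inE eqxx orbT.
  by case/eqP: wt; rewrite (Y w wD) 1?eq_sym // (Y t tD) // eq_sym.
have [E2|N2] := eqVneq (nbh D :&: far C) set0.
  exists (far C); first by right.
  by left; apply: (sub (far C) sC' NC' E2); rewrite FC'.
(* Both sides of [C] meet [nbh D], so [key] empties both corners of [far D], while [nbh C] misses
   [far D] as well. *)
exfalso; case/set0Pn: G0 => x xF; case: (sideP C x) => -[x1 x2 x3].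
- by move/setP/(_ x): (key C sC erefl N2); rewrite in_setI xF x1 inE.
- move: x2; rewrite NC !inE -orbA => /or3P[]/eqP E.
  + by move: xF; rewrite E in_far uD andbF.
  + by move: xF; rewrite E in_far pD.
  by rewrite E (negPf t'F) in xF.
have /setP/(_ x) : far D :&: far C = set0 by apply: (key (far C)) => //; rewrite FC'.
by rewrite in_setI xF x3 inE.
Qed.

End Cuts.

(** * Models of a minor *)

Section Connected.
Variables (V : finType) (g : rel V).

Definition conn (S : {set V}) : bool :=
  [forall x in S, forall y in S,
     connect [rel a b | [&& a \in S, b \in S & g a b]] x y].

Definition closed_in (S X : {set V}) : Prop :=
  forall x y, x \in S -> y \in S -> x \in X -> g x y -> y \in X.

Lemma conn_closed (S X : {set V}) (x y : V) :
  conn S -> closed_in S X -> x \in S -> y \in S -> x \in X -> y \in X.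
Proof.
move=> cS clX xS yS xX; move/forall_inP/(_ x xS)/forall_inP/(_ y yS): cS.
case/connectP => s; elim: s x xS xX => [|z s IH] x xS xX /= => [_ ->//|].
by case/andP => /and3P[_ zS xz]; apply: IH => //; apply: clX xz.
Qed.

Lemma conn_cut (S X : {set V}) (x y : V) :
  conn S -> x \in S -> y \in S -> x \in X -> y \notin X ->
  exists a b, [/\ a \in S, b \in S, a \in X, b \notin X & g a b].
Proof.
move=> cS xS yS xX yX.
have [/existsP[a /existsP[b /and5P H]]|H] :=
  boolP [exists a, exists b, [&& a \in S, b \in S, a \in X, b \notin X & g a b]].
  by exists a, b.
case/negP: yX; apply: (conn_closed cS _ xS yS xX) => a b aS bS aX ab.
apply: contraNT H => bX; apply/existsP; exists a; apply/existsP; exists b.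
by rewrite aS bS aX bX.
Qed.

Hypothesis g_sym : symmetric g.

Lemma closed_inC (S X : {set V}) : closed_in S X -> closed_in S (~: X).
Proof.
move=> clX x y xS yS; rewrite !in_setC => xX xy; apply: contra xX => yX.
by apply: clX yX _; rewrite // g_sym.
Qed.

(** A closed set and its complement cannot both contain [r]. Proofs of connectedness thus reduce to
    showing that every nonempty closed part reaches one chosen root. *)
Lemma conn_root (S : {set V}) (r : V) :
  (forall X x, closed_in S X -> x \in S -> x \in X -> r \in X) -> conn S.
Proof.
move=> root; apply/forall_inP => x xS; apply/forall_inP => y yS.
set e := [rel a b | _].
pose X := [set z | connect e x z].
have clX : closed_in S X.
  move=> a b aS bS; rewrite !inE => xa ab; apply: connect_trans xa (connect1 _).
  by rewrite /= aS bS.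
have xX : x \in X by rewrite inE connect0.
have rX := root X x clX xS xX.
suff : y \in X by rewrite inE.
apply: contraTT rX => yX; rewrite -in_setC.
by apply: root (closed_inC clX) yS _; rewrite in_setC.
Qed.

Lemma conn1 (x : V) : conn [set x].
Proof. by apply: (@conn_root _ x) => X y _; rewrite in_set1 => /eqP->. Qed.

End Connected.

Section Models.
Variables (V : finType) (g : rel V) (W : finType) (h : rel W).

Definition fibre (phi : V -> W) (w : W) : {set V} := [set x | phi x == w].

(** Branch sets are the fibres of a total map, so they partition the host graph. Contracting a set
    inside a branch set then amounts to factoring the map; [pmodel_total] shows that totality is no
    restriction for a nonempty minor of a 3-connected graph. *)
Definition model (phi : V -> W) : bool :=
  [&& [forall w, exists x, phi x == w],
      [forall w, conn g (fibre phi w)] &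
      [forall a, forall b, h a b ==>
         [exists x, exists y, [&& phi x == a, phi y == b & g x y]]]].

Lemma modelP (phi : V -> W) :
  reflect [/\ forall w, exists x, phi x = w,
              forall w, conn g (fibre phi w) &
              forall a b, h a b -> exists x y, [/\ phi x = a, phi y = b & g x y]]
          (model phi).
Proof.
apply: (iffP and3P) => -[H1 H2 H3]; split.
- by move=> w; case/existsP: (forallP H1 w) => x /eqP; exists x.
- by move=> w; apply: (forallP H2 w).
- move=> a b ab; move: (forallP H3 a) => /forallP/(_ b); rewrite ab.
  by case/existsP => x /existsP[y /and3P[/eqP xa /eqP yb xy]]; exists x, y.
- by apply/forallP => w; apply/existsP; case: (H1 w) => x /eqP; exists x.
- by apply/forallP.
apply/forallP => a; apply/forallP => b; apply/implyP => /H3[x [y [xa yb xy]]].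
by apply/existsP; exists x; apply/existsP; exists y; rewrite xa yb !eqxx.
Qed.

Lemma in_fibre (phi : V -> W) (w : W) (x : V) : (x \in fibre phi w) = (phi x == w).
Proof. by rewrite inE. Qed.

Lemma eq_model (phi psi : V -> W) : phi =1 psi -> model phi -> model psi.
Proof.
move=> E /modelP[H1 H2 H3]; apply/modelP; split.
- by move=> w; case: (H1 w) => x <-; exists x.
- move=> w; suff -> : fibre psi w = fibre phi w by [].
  by apply/setP => x; rewrite !inE E.
by move=> a b /H3[x [y [xa yb xy]]]; exists x, y; rewrite -!E.
Qed.

(* [safe S]: contracting the connected set S preserves an H-minor. *)
Definition safe (S : {set V}) : bool :=
  [exists phi : {ffun V -> W},
     model phi && [forall x in S, forall y in S, phi x == phi y]].

Lemma safeP (S : {set V}) :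
  reflect (exists2 phi : V -> W, model phi &
             forall x y, x \in S -> y \in S -> phi x = phi y)
          (safe S).
Proof.
apply: (iffP existsP) => [[phi /andP[M C]]|[phi M C]].
  exists phi => // x y xS yS.
  by move/forall_inP/(_ x xS)/forall_inP/(_ y yS)/eqP: C.
exists (finfun phi); rewrite (eq_model _ M) /=; last by move=> x; rewrite ffunE.
apply/forall_inP => x xS; apply/forall_inP => y yS; rewrite !ffunE.
by apply/eqP; apply: C.
Qed.

Lemma safeS (S T : {set V}) : S \subset T -> safe T -> safe S.
Proof.
move=> /subsetP ST /safeP[phi M C]; apply/safeP; exists phi => // x y xS yS.
by apply: C; apply: ST.
Qed.

Hypothesis g_sym : symmetric g.
Hypothesis g_irr : irreflexive g.
Hypothesis g_con3 : con3 g.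
Hypothesis h_irr : irreflexive h.
Hypothesis h_con3 : con3 h.

(** Every branch set that meets [A] also leaves it through the cut {a, b, t}, so only those of [a]
    and of [t] meet [A]. Giving all of [A] to the branch set of [a] can therefore destroy only the
    adjacency between these two, and an edge from [A] to [t] restores it. *)
Lemma safe_absorb (phi : V -> W) (A : {set V}) (a b : V) :
  model phi -> sep3 g A -> a \in nbh g A -> b \in nbh g A -> a != b ->
  phi a = phi b -> (forall w, exists2 x, x \notin A & phi x = w) ->
  safe (A :|: [set a; b]).
Proof.
move=> M sA aN bN ab phiab out; have [A0 F0 A3] := sA.
have [phisurj phiconn phiedge] := modelP _ M.
have [t NA] := set3E A3 aN bN ab.
have tN : t \in nbh g A by rewrite NA !inE eqxx orbT.
have tA := nbh_notin tN.
have N3 y : y \in nbh g A -> phi y = phi a \/ y = t.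
  rewrite NA !inE -orbA => /or3P[]/eqP->; by [left | left | right].
have inA x : x \in A -> phi x = phi a \/ phi x = phi t.
  move=> xA; have [y yA yx] := out (phi x).
  have [||c [d [cf df cA dA cd]]] := conn_cut (phiconn (phi x)) _ _ xA yA.
  - by rewrite in_fibre.
  - by rewrite in_fibre yx.
  rewrite !in_fibre in cf df; rewrite -(eqP df).
  by case: (N3 d (mem_nbh cA cd dA)) => ->; [left | right].
pose psi x := if x \in A then phi a else phi x.
apply/safeP; exists psi; last first.
  by move=> x y; rewrite !inE /psi; do 2![case: ifP => //= _];
     do ?[case/orP => /eqP->]; rewrite ?phiab // => _ /orP[]/eqP-> ; rewrite ?phiab.
apply/modelP; split.
- by move=> w; case: (out w) => x xA; exists x; rewrite /psi (negPf xA).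
- move=> w; have [->|wa] := eqVneq w (phi a).
    apply: (@conn_root _ _ g_sym _ a) => X x clX xQ xX.
    have fQ y : phi y = phi a -> y \in fibre psi (phi a).
      by move=> E; rewrite in_fibre /psi E; case: ifP.
    have step1 y z : phi y = phi a -> phi z = phi a -> y \in X -> z \in X.
      move=> ya za; apply: (conn_closed (phiconn (phi a))); rewrite ?in_fibre ?ya ?za //.
      by move=> c d; rewrite !in_fibre => /eqP ca /eqP da; apply: clX; apply: fQ.
    have [xa|xa] := eqVneq (phi x) (phi a); first exact: step1 xX.
    have xA : x \in A.
      by move: xQ; rewrite in_fibre /psi; case: ifP => // _; rewrite (negPf xa).
    apply: contraT => aX.
    (* A closed part of [A] that does not reach [a] can be left only through [t], so it has at most
       one neighbour and is empty. *)
    have : nbh g (X :&: A) \subset [set t; t].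
      apply/subsetP => z /nbhP[zY [y /setIP[yX yA] yz]].
      have yQ : y \in fibre psi (phi a) by rewrite in_fibre /psi yA.
      have zX : z \in fibre psi (phi a) -> z \in X by move=> zQ; apply: clX yX yz.
      have zA : z \notin A.
        by apply: contra zY => zA; rewrite in_setI zA zX // in_fibre /psi zA.
      case: (N3 z (mem_nbh yA yz zA)) => [za|->]; last by rewrite !inE eqxx.
      by case/negP: aX; apply: (step1 z) => //; apply/zX/fQ.
    move=> /(small_set0 g_con3 F0 (subsetIr _ _)).
    by move=> /setP/(_ x); rewrite in_setI xX xA inE.
  apply/forall_inP => x xQ; apply/forall_inP => y yQ.
  have fE z : (z \in fibre psi w) = (z \notin A) && (phi z == w).
    by rewrite in_fibre /psi; case: ifP => //= _; rewrite eq_sym (negPf wa).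
  have : y \in [set z | connect [rel c d | [&& c \in fibre psi w,
    d \in fibre psi w & g c d]] x z].
    set X := [set z | _].
    have clX : closed_in g (fibre psi w) X.
      move=> c d cQ dQ; rewrite !inE => xc cd; apply: connect_trans xc (connect1 _).
      by rewrite /= cQ dQ.
    have xX : x \in X by rewrite inE connect0.
    rewrite !fE in xQ yQ; case/andP: xQ => xA xw; case/andP: yQ => yA yw.
    (* The old branch set may run through [A] but can enter it only at [t]; its part inside [A] is
       put on the same side as [t], which keeps the set closed. *)
    pose X' := if t \in X then X :|: A else X :\: A.
    have xX' : x \in X' by rewrite /X'; case: ifP => _; rewrite !inE ?xA; move: xX;
      rewrite inE => ->.
    suff : y \in X'.
      by rewrite /X'; case: ifP => _; rewrite ?in_setU ?in_setD ?(negPf yA) ?orbF //= yA.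
    apply: conn_closed (phiconn w) _ _ _ xX'; rewrite ?in_fibre // => c d.
    rewrite !in_fibre => cw dw.
    have Nt z : z \in nbh g A -> phi z == w -> z = t.
      by case/N3 => // -> /eqP E; rewrite E eqxx in wa.
    rewrite /X'; case: ifP => tX.
      rewrite !in_setU; case: (boolP (d \in A)) => dA; first by rewrite orbT.
      rewrite orbF; case: (boolP (c \in A)) => cA.
        by move=> _ cd; rewrite (Nt d) // (mem_nbh cA cd dA).
      by rewrite orbF; apply: clX; rewrite fE ?cA ?dA.
    rewrite !in_setD => /andP[cA cX] cd; have dA : d \notin A.
      apply/negP => dA; have E : c = t by apply: Nt => //; apply: mem_nbh dA _ cA;
        rewrite g_sym.
      by rewrite -E cX in tX.
    by rewrite dA; apply: clX cX cd; rewrite fE ?cA ?dA.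
  by rewrite inE.
move=> c d cd; have [x [y [xc yd xy]]] := phiedge _ _ cd.
have cdn : c != d by apply: contraTneq cd => ->; rewrite h_irr.
have [xA|xA] := boolP (x \in A); last first.
  have [yA|yA] := boolP (y \in A); last by exists x, y;
    rewrite /psi (negPf xA) (negPf yA).
  have xN : x \in nbh g A by apply: mem_nbh yA _ xA; rewrite g_sym.
  have : (c = phi a /\ d = phi t) \/ (c = phi t /\ d = phi a).
    move: cdn; rewrite -xc -yd; case: (inA y yA) => ->; case: (N3 x xN) => ->;
      rewrite ?eqxx //; by [left|right].
  have /nbhP[_ [z zA zt]] := tN.
  by case=> -[-> ->]; [exists z, t | exists t, z]; rewrite /psi zA (negPf tA) // g_sym.
have yN : phi y = phi a \/ phi y = phi t.
  have [yA|yA] := boolP (y \in A); first exact: inA.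
  by case: (N3 y (mem_nbh xA xy yA)) => ->; [left | right].
have : (c = phi a /\ d = phi t) \/ (c = phi t /\ d = phi a).
  by move: cdn; rewrite -xc -yd; case: (inA x xA) => ->; case: yN => ->;
    rewrite ?eqxx //; by [left|right].
have /nbhP[_ [z zA zt]] := tN.
by case=> -[-> ->]; [exists z, t | exists t, z]; rewrite /psi zA (negPf tA) // g_sym.
Qed.

(* Since H is 3-connected, only one side of a cut can contain branch sets. *)
Lemma safe_side (A : {set V}) (a b : V) :
  sep3 g A -> a \in nbh g A -> b \in nbh g A -> a != b -> safe [set a; b] ->
  safe (A :|: [set a; b]) \/ safe (far g A :|: [set a; b]).
Proof.
move=> sA aN bN ab /safeP[phi M C].
have phiab : phi a = phi b by apply: C; rewrite !inE eqxx ?orbT.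
have [sF NF FF] := sep3_far g_sym g_con3 sA.
have [phisurj phiconn phiedge] := modelP _ M.
have [t NA] : exists t, nbh g A = [set a; b; t] by case: sA => _ _ A3; apply: set3E.
have [out|] := boolP [forall w, exists x, (x \notin A) && (phi x == w)].
  left; apply: safe_absorb M sA aN bN ab phiab _ => w.
  by case/existsP: (forallP out w) => x /andP[xA /eqP]; exists x.
rewrite negb_forall => /existsP[w1 /existsPn H1]; right.
have in1 x : phi x = w1 -> x \in A.
  by move=> E; move: (H1 x); rewrite E eqxx andbT negbK.
apply: (safe_absorb M sF _ _ ab phiab); rewrite ?NF // => w2.
apply/exists_eq_inP; apply: contraT; rewrite negb_exists_in => /forall_inP H2.
have in2 x : phi x = w2 -> x \in far g A.
  by move=> E; apply: contraTT (eqxx w2) => xF; rewrite -{1}E H2.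
(* A neighbour of [P] in H has a branch set meeting [nbh g A]. Since [phi a = phi b] only two such
   vertices are possible, yet [P] would separate [w1] from [w2] in the 3-connected graph H. *)
pose P := [set w | fibre phi w \subset A].
have Pnb : nbh h P \subset [set phi a; phi t].
  apply/subsetP => w /nbhP[wP [w' w'P w'w]].
  have [x [y [xw' yw xy]]] := phiedge _ _ w'w.
  rewrite inE in w'P; have xA : x \in A by apply: (subsetP w'P); rewrite in_fibre xw'.
  have : [exists z in nbh g A, phi z == w].
    have [yA|yA] := boolP (y \in A); last first.
      by apply/exists_inP; exists y; rewrite ?yw //; apply: mem_nbh xA xy yA.
    rewrite inE in wP; case/subsetPn: wP => z zw zA.
    have yf : y \in fibre phi w by rewrite in_fibre yw.
    have [c [d [_ df cA dA cd]]] := conn_cut (phiconn w) yf zw yA zA.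
    apply/exists_inP; exists d; first exact: mem_nbh cA cd dA.
    by rewrite in_fibre in df.
  case/exists_inP => z; rewrite NA => /setUP[/set2P[]|/set1P]-> /eqP<-;
    by rewrite -?phiab !inE ?eqxx ?orbT.
have w1P : w1 \in P by rewrite inE; apply/subsetP => x; rewrite in_fibre => /eqP/in1.
have w2F : w2 \in far h P.
  have [x xw2] := phisurj w2; have := in2 x xw2.
  rewrite in_far; move=> xF; rewrite in_far inE; apply/andP; split.
    apply/subsetPn; exists x; rewrite ?in_fibre ?xw2 //.
    by case/andP: xF.
  apply/negP => w2N; have := subsetP Pnb _ w2N; rewrite !inE => /orP[]/eqP E.
    by have := in2 a (esym E); rewrite in_far aN andbF.
  by have := in2 t (esym E); rewrite in_far NA !inE eqxx orbT andbF.
have : 2 < #|nbh h P|.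
  by apply: h_con3; apply/set0Pn; [exists w1 | exists w2].
rewrite ltnNge (leq_trans (subset_leq_card Pnb)) //.
by rewrite cards2; case: eqP.
Qed.

(** The vertex [p] changes to the branch set of its neighbour [v]. By [own], the vertex [q] takes
    over its connecting role in the old branch set; by [nbp], only the adjacency between the two
    branch sets is at stake, and the edge p q now provides it. *)
Lemma model_move (phi : V -> W) (p q v : V) :
  model phi -> g p v -> g p q -> phi q = phi p ->
  (forall x, g p x -> phi x = phi p -> x = q \/ g q x) ->
  (forall x, g p x -> phi x = phi p \/ phi x = phi v) ->
  model (fun x => if x == p then phi v else phi x).
Proof.
move=> M pv pq qp own nbp; have [phisurj phiconn phiedge] := modelP _ M.
have [vp|vp] := eqVneq (phi v) (phi p).
  by apply: eq_model M => x; case: eqP => // ->.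
have qnp : q != p by apply: contraTneq pq => ->; rewrite g_irr.
set psi := fun x => _; apply/modelP; split.
- move=> w; case: (phisurj w) => x xw.
  have [E|xp] := eqVneq x p; last by exists x; rewrite /psi (negPf xp).
  by exists q; rewrite /psi (negPf qnp) qp -E.
- move=> w; have [->|wp] := eqVneq w (phi p).
    have fE z : (z \in fibre psi (phi p)) = (z != p) && (phi z == phi p).
      by rewrite in_fibre /psi; case: (eqVneq z p) => [_|_] /=; rewrite ?(negPf vp).
    apply: (@conn_root _ _ g_sym _ q) => X x clX; rewrite fE => /andP[xp xf] xX.
    have qf : q \in fibre psi (phi p) by rewrite fE qnp qp eqxx.
    apply: contraT => qX.
    suff : q \in X :\ p by rewrite in_setD1 (negPf qX) andbF.
    apply: (@conn_closed _ _ _ _ x q (phiconn (phi p))); rewrite ?in_fibre ?qp //;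
      last first.
      by rewrite in_setD1 xp xX.
    move=> c d; rewrite !in_fibre => cp dp /setD1P[cnp cX] cd.
    have cf : c \in fibre psi (phi p) by rewrite fE cnp.
    have [E|dnp] := eqVneq d p; last first.
      by rewrite in_setD1 dnp; apply: clX cf _ cX cd; rewrite fE dnp.
    rewrite E in cd dp; case/negP: qX.
    have [||<-//|qc] := own c; [by rewrite g_sym | exact/eqP | ].
    by apply: clX cf qf cX _; rewrite g_sym.
  have [->|wv] := eqVneq w (phi v).
    apply: (@conn_root _ _ g_sym _ v) => X x clX.
    have fv z : phi z = phi v -> z \in fibre psi (phi v).
      by move=> E; rewrite in_fibre /psi E; case: (z =P p) => _; rewrite eqxx.
    rewrite in_fibre /psi; have [->|xp] := eqVneq x p => xf xX.
      by apply: clX xX pv; [rewrite in_fibre /psi !eqxx | apply: fv].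
    apply: conn_closed (phiconn (phi v)) _ _ _ xX; rewrite ?in_fibre //.
    by move=> c d; rewrite !in_fibre => /eqP cv /eqP dv; apply: clX; apply: fv.
  suff -> : fibre psi w = fibre phi w by [].
  apply/setP => x; rewrite !in_fibre /psi; case: (x =P p) => // ->.
  by rewrite ![_ == w]eq_sym (negPf wp) (negPf wv).
move=> a b ab; have [x [y [xa yb xy]]] := phiedge _ _ ab.
have abn : a != b by apply: contraTneq ab => ->; rewrite h_irr.
have [E|xp] := eqVneq x p.
  have [|F|F] := nbp y; first by rewrite -E.
    by move: abn; rewrite -xa -yb E F eqxx.
  by exists q, p; split; rewrite /psi ?(negPf qnp) ?eqxx;
    [rewrite qp -E | rewrite -F | rewrite g_sym].
have [E|yp] := eqVneq y p; last by exists x, y; rewrite /psi (negPf xp) (negPf yp).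
have [|F|F] := nbp x; first by rewrite -E g_sym.
  by move: abn; rewrite -xa -yb E F eqxx.
by exists p, q; split; rewrite /psi ?(negPf qnp) ?eqxx; [rewrite -F | rewrite qp -E | ].
Qed.

End Models.

(** * Contractible edges at an isolated vertex *)

Section Keep.
Variables (V : finType) (g : rel V) (W : finType) (h : rel W).

(* For a connected set S of a 3-connected graph G: the graph G/S is 3-connected. *)
Definition ctr3 (S : {set V}) : bool :=
  [forall A : {set V},
     [&& A != set0, [disjoint A & S] & A :|: nbh g A :|: S != setT] ==>
     (1 < #|nbh g A :\: S|)].

(* The H-contractible edges, seen on the vertices of G. *)
Definition contractible : rel V :=
  [rel a b | [&& g a b, safe g h [set a; b] & ctr3 [set a; b]]].

Definition isolated (u : V) : bool := [forall v, ~~ contractible u v].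

(* A side of a 3-cut around the edge u q that no branch set needs. *)
Definition free_side (u q : V) (D : {set V}) : Prop :=
  [/\ sep3 g D, u \in nbh g D, q \in nbh g D, g u q & safe g h (D :|: [set u; q])].

Definition nb (x : V) : {set V} := [set y | g x y].

Definition triple (u p q : V) : Prop :=
  [/\ [/\ g u p, g u q & g p q], #|nb p| = 3, #|nb q| = 3 & safe g h [set u; p; q]].

Hypothesis g_sym : symmetric g.
Hypothesis g_irr : irreflexive g.
Hypothesis g_con3 : con3 g.
Hypothesis h_irr : irreflexive h.
Hypothesis h_con3 : con3 h.

Lemma ctr3P (S A : {set V}) (x : V) : ctr3 S -> A != set0 -> [disjoint A & S] ->
  x \notin A -> x \notin nbh g A -> x \notin S -> 1 < #|nbh g A :\: S|.
Proof.
move=> cS A0 AS xA xN xS; move/forallP/(_ A): cS; rewrite A0 AS /= => /implyP; apply.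
by apply/negP => /eqP/setP/(_ x); rewrite !in_setU (negPf xA) (negPf xN) (negPf xS) inE.
Qed.

Lemma contractible_sym : symmetric contractible.
Proof. by move=> a b; rewrite /contractible /= g_sym setUC. Qed.

Lemma edge_neq (a b : V) : g a b -> a != b.
Proof. by move=> ab; apply: contraTneq ab => ->; rewrite g_irr. Qed.

Lemma in_nb (x y : V) : (y \in nb x) = g x y.
Proof. by rewrite inE. Qed.

Lemma nbh1 (x : V) : nbh g [set x] = nb x.
Proof.
apply/setP => y; rewrite in_nb; apply/nbhP/idP => [[_ [z /set1P->]]|] // xy.
by rewrite in_set1 eq_sym edge_neq //; split=> //; exists x; rewrite ?in_set1.
Qed.

(** A violating set has at most one neighbour outside {a, b} but at least three in all, hence
    exactly three, [a] and [b] among them. *)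
Lemma not_ctr3 (a b : V) : a != b -> ~~ ctr3 [set a; b] ->
  exists A, [/\ sep3 g A, a \in nbh g A & b \in nbh g A].
Proof.
move=> ab; rewrite negb_forall => /existsP[A]; rewrite negb_imply -leqNgt.
case/andP => /and3P[A0 dis full] le1.
have /set0Pn[x] : ~: (A :|: nbh g A :|: [set a; b]) != set0.
  by apply: contraNneq full => E; rewrite -[_ :|: _]setCK E setC0.
rewrite in_setC !in_setU !negb_or -in_far => /andP[xF _].
have F0 : far g A != set0 by apply/set0Pn; exists x.
have N3 := g_con3 A0 F0.
have E2 := cards2 a b; rewrite ab in E2.
have CI := cardsID [set a; b] (nbh g A).
have SI : [set a; b] \subset nbh g A.
  have := subset_leq_card (subsetIr (nbh g A) [set a; b]).
  rewrite E2 => le2; have /eqP E : #|nbh g A :&: [set a; b]| == #|[set a;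
    b]| by rewrite E2; lia.
  apply/setIidPr/eqP; by rewrite eqEcard subsetIr E /=.
exists A; split; rewrite ?(subsetP SI) // ?inE ?eqxx ?orbT //.
split=> //; move/setIidPr: SI => SI; move: CI; rewrite SI E2; lia.
Qed.

Lemma isolated_sep (u q : V) : isolated u -> g u q -> safe g h [set u; q] ->
  exists A, [/\ sep3 g A, u \in nbh g A & q \in nbh g A].
Proof.
move=> iu uq sq; apply: not_ctr3 (edge_neq uq) _.
by move/forallP/(_ q): iu; rewrite /contractible /= uq sq.
Qed.

Lemma isolated_free_side (u q : V) : isolated u -> g u q -> safe g h [set u; q] ->
  exists A, [/\ sep3 g A, u \in nbh g A, q \in nbh g A &
    free_side u q A \/ free_side u q (far g A)].
Proof.
move=> iu uq sq; have [A [sA uA qA]] := isolated_sep iu uq sq.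
have [sF NF FF] := sep3_far g_sym g_con3 sA.
exists A; split=> //.
by case: (safe_side g_sym g_con3 h_irr h_con3 sA uA qA (edge_neq uq) sq) => sf;
   [left | right]; split; rewrite ?NF.
Qed.

(** Applied to the corners left by [uncross]: a nonempty corner with three candidate neighbours
    needs all of them and is again a side of a 3-cut. *)
Lemma sep3_sub (A D : {set V}) (a b c : V) : sep3 g D -> A \subset D ->
  A != set0 -> nbh g A \subset [set a; b; c] -> sep3 g A /\ nbh g A = [set a; b; c].
Proof.
move=> [_ F0 _] AD A0 NA.
have FA : far g A != set0.
  by case/set0Pn: F0 => x xF; apply/set0Pn; exists x; apply: (subsetP (far_sub g AD)).
have N3 := g_con3 A0 FA.
have le3 : #|[set a; b; c]| <= 3.
  by rewrite -setUA cardsU1 cards2; case: (_ \notin _); case: (_ != _).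
have E : nbh g A = [set a; b; c].
  by apply/eqP; rewrite eqEcard NA (leq_trans le3).
split=> //; split=> //; apply/eqP; rewrite eqn_leq N3 andbT.
by rewrite (leq_trans (subset_leq_card NA)).
Qed.

(** A free side that cannot be made smaller is a single vertex, which then has degree 3. For a
    neighbour [p] of [u] in [D], the 3-cut around u p is uncrossed with [D]; unless both corners are
    empty, this gives a smaller free side around u p. *)
Lemma free_side_deg3 (u q : V) (D : {set V}) : isolated u -> free_side u q D ->
  exists p, [/\ p \in D, g u p & #|nb p| = 3].
Proof.
move=> iu; have [n] := ubnP #|D|; elim: n D q => // n IH D q Dn [sD uD qD uq sfD].
have uq' := edge_neq uq; have [_ _ D3] := sD.
have [t ND] := set3E D3 uD qD uq'.
have [[p pD up] _] := nbh_side g_sym g_con3 sD uD.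
have sfp : safe g h [set u; p].
  by apply: safeS sfD; apply/subsetP => x; rewrite !inE => /orP[]/eqP->;
    rewrite ?eqxx ?pD ?orbT.
have [C [sC uC pC]] := isolated_sep iu up sfp.
have pNC := nbh_notin pC.
(* Safety is inherited because [D'] with u and p is contained in [D] with u; the induction applies
   because [p] lies in [D] but not in [D']. *)
have rec (D' : {set V}) : D' \subset D -> p \notin D' -> sep3 g D' -> u \in nbh g D' ->
  p \in nbh g D' ->
    exists p, [/\ p \in D, g u p & #|nb p| = 3].
  move=> D'D pD' sD' uD' pD''.
  have [||r [rD ur r3]] := IH D' p.
  - apply: (@leq_trans #|D|) => //; apply: proper_card; apply/properP; split=> //.
    by exists p.
  - split=> //; apply: safeS sfD; apply/subsetP => x;
    rewrite !inE => /or3P[/(subsetP D'D)->//||]/eqP->;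
    by rewrite ?eqxx ?pD ?orbT.
  by exists r; split=> //; apply: (subsetP D'D).
have [sF NF FF] := sep3_far g_sym g_con3 sC.
have pF : p \notin far g C by rewrite in_far pC andbF.
have [C1 C1C [C1D|[wC1 tC1 N1 N2 E]]] := uncross g_sym g_con3 sC sD ND uC pC pD.
  by case: C1C => C1E; apply: (rec C1); rewrite ?C1E ?NF //; rewrite -C1E.
have pC1 : p \notin C1 by case: C1C => ->.
have pFC1 : p \notin far g C1 by case: C1C => ->; rewrite ?FF.
have NC1 : nbh g C1 = nbh g C by case: C1C => ->.
have [E1|n1] := eqVneq (D :&: C1) set0; last first.
  have [s1 NE] := sep3_sub sD (subsetIl _ _) n1 N1.
  apply: rec s1 _ _; rewrite ?subsetIl ?in_setI ?pD ?pC1 // NE !inE eqxx ?orbT //.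
have [E2|n2] := eqVneq (D :&: far g C1) set0; last first.
  have [s1 NE] := sep3_sub sD (subsetIl _ _) n2 N2.
  apply: rec s1 _ _; rewrite ?subsetIl ?in_setI ?pD ?pFC1 // NE !inE eqxx ?orbT //.
have Dp : D = [set p].
  apply/setP => x; rewrite -E in_setI -NC1; case: (sideP g C1 x) => -[x1 x2 x3];
    rewrite ?x2 ?(negPf x2) ?andbT ?andbF //.
    by move/setP/(_ x): E1; rewrite in_setI x1 inE andbT.
  by move/setP/(_ x): E2; rewrite in_setI x3 inE andbT.
by exists p; split=> //; rewrite -nbh1 -Dp.
Qed.

(** Both sides of the cut contain a neighbour of [p], and [u] in the cut uses up the third place. *)
Lemma nb_split (C : {set V}) (p u : V) : sep3 g C -> p \in nbh g C ->
  #|nb p| = 3 -> g p u -> u \in nbh g C ->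
  exists c1 c2, [/\ nb p :&: C = [set c1], nb p :&: far g C = [set c2] &
    nb p = [set u; c1; c2]].
Proof.
move=> sC pC p3 pu uC.
have [[c1 c1C pc1] [c2 c2C pc2]] := nbh_side g_sym g_con3 sC pC.
have c1F : c1 \notin far g C by rewrite in_far c1C.
have c2n : c2 \notin C by move: c2C; rewrite in_far => /andP[].
have uC1 : u \notin C := nbh_notin uC.
have uF : u \notin far g C by rewrite in_far uC andbF.
have E : nb p = [set u; c1; c2].
  apply/esym/eqP; rewrite eqEcard p3; apply/andP; split.
    by apply/subsetP => x; rewrite !inE -orbA => /or3P[]/eqP->.
  rewrite -setUA cardsU1 cards2 !inE negb_or.
  have -> : u != c1 by apply: contraNneq uC1 => ->.
  have -> : u != c2 by apply: contraNneq uF => ->.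
  by have -> : c1 != c2 by apply: contraNneq c2n => <-.
exists c1, c2; split=> //; apply/setP => x; rewrite E in_setI !in_setU !in_set1.
  have [->|xc1] := eqVneq x c1; first by rewrite c1C orbT.
  have [->|xu] := eqVneq x u; first by rewrite (negPf uC1).
  by have [->|] := eqVneq x c2; rewrite ?(negPf c2n).
have [->|xc2] := eqVneq x c2; first by rewrite c2C orbT.
have [->|xu] := eqVneq x u; first by rewrite (negPf uF).
by have [->|] := eqVneq x c1; rewrite ?(negPf c1F).
Qed.

(** The induction carries the invariant that [q] is cubic with exactly one neighbour in the free
    side. It survives each uncrossing, and when the side has shrunk to one vertex [p], that vertex
    is the neighbour of [q], which closes the triangle. *)
Lemma free_side_triple (u q r : V) (D : {set V}) : isolated u -> free_side u q D ->
  #|nb q| = 3 -> nb q :&: D = [set r] -> exists p q, triple u p q.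
Proof.
move=> iu; have [n] := ubnP #|D|; elim: n D q r => // n IH D q r Dn fD q3 qr.
have [sD uD qD uq sfD] := fD; have [_ _ D3] := sD.
have [t ND] := set3E D3 uD qD (edge_neq uq).
have [p [pD up p3]] := free_side_deg3 iu fD.
have sub_safe (A : {set V}) : A \subset D -> safe g h (A :|: [set u; q]).
  by move=> AD; apply: safeS sfD; apply: setSU.
have sub_safe' (A : {set V}) : A \subset D -> safe g h (A :|: [set u; p]).
  move=> /subsetP AD; apply: safeS sfD; apply/subsetP => x; rewrite !inE.
  by case/or3P => [/AD->//||] /eqP->; rewrite ?pD ?eqxx ?orbT.
have sfp : safe g h [set u; p].
  by rewrite -[X in safe _ _ X]set0U; apply: sub_safe' (sub0set _).
have [C [sC uC pC]] := isolated_sep iu up sfp.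
have [sF NF FF] := sep3_far g_sym g_con3 sC.
have lt (A : {set V}) : A \subset D -> p \notin A -> #|A| < n.
  move=> AD pA; apply: (@leq_trans #|D|) => //; apply: proper_card; apply/properP.
  by split=> //; exists p.
have pC0 := nbh_notin pC.
have pF0 : p \notin far g C by rewrite in_far pC andbF.
have rec1 C1 : sep3 g C1 -> nbh g C1 = nbh g C -> p \notin C1 -> C1 \subset D ->
    exists p q, triple u p q.
  move=> s1 N1 pC1 C1D.
  have [||||c1 [c2 [E1 _ _]]] := @nb_split C1 p u s1; rewrite ?N1 // 1?g_sym //.
  apply: (IH C1 p c1) => //; first exact: lt.
  by split; rewrite ?N1 //; apply: sub_safe'.
have [C1 C1C [C1D|[wC1 tC1 N1 N2 E]]] := uncross g_sym g_con3 sC sD ND uC pC pD.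
  by case: C1C => C1E; apply: (rec1 C1); rewrite C1E // -C1E.
have NC1 : nbh g C1 = nbh g C by case: C1C => ->.
have sC1 : sep3 g C1 by case: C1C => ->.
have pC1 : p \notin C1 by case: C1C => ->.
have pFC1 : p \notin far g C1 by case: C1C => ->; rewrite ?FF.
have rD : r \in D by have /setP/(_ r) := qr; rewrite in_setI in_set1 eqxx => /andP[].
have qr' : g q r by have /setP/(_ r) := qr; rewrite in_setI in_set1 eqxx in_nb => /andP[].
have qn x : g q x -> x \in D -> x = r.
  by move=> qx xD; apply/set1P; rewrite -qr in_setI in_nb qx.
(* If [r] differs from [p], it is not in the cut of [C], hence on the side [C1] of its neighbour
   [q]; the corner of [D] in [C1] is a smaller free side still around u q. *)
have [rp|rp] := eqVneq r p; last first.
  have rC1 : r \in C1.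
    have := sideP g C1 r; case=> -[// r1 r2 r3].
      have /setP/(_ r) := E; rewrite in_setI in_set1 rD -NC1 r2 => /esym/eqP rp'.
      by rewrite rp' eqxx in rp.
    by rewrite (far_edge wC1 r3) in qr'.
  have n1 : D :&: C1 != set0 by apply/set0Pn; exists r; rewrite in_setI rD.
  have [s1 NE] := sep3_sub sD (subsetIl _ _) n1 N1.
  apply: (IH (D :&: C1) q r) => //.
  - by apply: lt; rewrite ?subsetIl // in_setI pD.
  - by split; rewrite ?NE ?inE ?eqxx ?orbT //; apply/sub_safe/subsetIl.
  by rewrite setIA qr; apply/setIidPl; rewrite sub1set.
have E1 : D :&: C1 = set0.
  apply/eqP; apply: contraT => n1.
  have [s1 NE] := sep3_sub sD (subsetIl _ _) n1 N1.
  have : q \in nbh g (D :&: C1) by rewrite NE !inE eqxx orbT.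
  case/nbhP => _ [x /setIP[xD xC1]]; rewrite g_sym => qx.
  by rewrite -rp -(qn x) ?xC1 in pC1.
(* Either [D] is reduced to [p], or the other corner is a smaller free side around u p, in which the
   cubic vertex [p] has one neighbour by [nb_split]. *)
have [E2|n2] := eqVneq (D :&: far g C1) set0.
  have Dp : D = [set p].
    apply/setP => x; rewrite -E in_setI -NC1; case: (sideP g C1 x) => -[x1 x2 x3];
      rewrite ?x2 ?(negPf x2) ?andbT ?andbF //.
      by move/setP/(_ x): E1; rewrite in_setI x1 inE andbT.
    by move/setP/(_ x): E2; rewrite in_setI x3 inE andbT.
  exists q, p; split=> //; first by split; rewrite -?rp // rp.
  by rewrite Dp setUC in sfD.
have [s2 NE] := sep3_sub sD (subsetIl _ _) n2 N2.
have [||||c1 [c2 [_ Ec2 _]]] := @nb_split C1 p u sC1; rewrite ?NC1 // 1?g_sym //.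
have pN2 : p \in nbh g (D :&: far g C1) by rewrite NE !inE eqxx orbT.
apply: (IH (D :&: far g C1) p c2) => //.
- by apply: lt; rewrite ?subsetIl // in_setI pD.
- by split; rewrite // ?NE ?inE ?eqxx ?orbT //; apply/sub_safe'/subsetIl.
case/nbhP: pN2 => _ [y yDF]; rewrite g_sym => py.
rewrite setIA (setIAC _ D) Ec2; apply/setIidPl; rewrite sub1set.
have : y \in nb p :&: far g C1 by rewrite in_setI in_nb py; case/setIP: yDF.
by rewrite Ec2 in_set1 => /eqP<-; case/setIP: yDF.
Qed.

(** [free_side_triple] must start at an edge with a cubic end. [free_side_deg3] supplies such an
    edge u p, and whichever side of its 3-cut is free contains just one neighbour of [p]. *)
Lemma isolated_triple (u w : V) : isolated u -> g u w -> safe g h [set u; w] ->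
  exists p q, triple u p q.
Proof.
move=> iu uw suw; have [A [sA uA wA fA]] := isolated_free_side iu uw suw.
have [D fD] : exists D, free_side u w D by case: fA; [exists A | exists (far g A)].
have [p [pD up p3]] := free_side_deg3 iu fD.
have sup : safe g h [set u; p].
  case: fD => _ _ _ _; apply: safeS; apply/subsetP => x; rewrite !inE.
  by case/orP => /eqP->; rewrite ?pD ?eqxx ?orbT.
have [C [sC uC pC fC]] := isolated_free_side iu up sup.
have [|c1 [c2 [E1 E2 _]]] := nb_split sC pC p3 _ uC; first by rewrite g_sym.
by case: fC => fC; apply: free_side_triple iu fC p3 _; eassumption.
Qed.

(* A 3-cut around p y would separate the adjacent vertices u and q. *)
Lemma contractible_third (u p q y : V) : g u p -> g u q -> g p q -> #|nb p| = 3 ->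
  safe g h [set u; p; q] -> g p y -> y != u -> y != q -> contractible p y.
Proof.
move=> up uq pq p3 sT py yu yq.
have pu : g p u by rewrite g_sym.
have [c Np] : exists c, nb p = [set u; q; c].
  by apply: set3E p3 _ _ (edge_neq uq); rewrite in_nb.
have cy : c = y.
  by have := in_nb p y; rewrite py Np !inE (negPf yu) (negPf yq) /= => /eqP.
rewrite {}cy in Np.
rewrite /contractible /= py /=; apply/andP; split.
  have /safeP[phi M C] := sT.
  have pT : p \in [set u; p; q] by rewrite !inE eqxx orbT.
  have uT : u \in [set u; p; q] by rewrite !inE eqxx.
  have qT : q \in [set u; p; q] by rewrite !inE eqxx orbT.
  have np x : g p x -> [\/ x = u, x = q | x = y].
    by rewrite -in_nb Np !inE -orbA => /or3P[]/eqP;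
      [apply: Or31 | apply: Or32 | apply: Or33].
  have [yp|yp] := eqVneq (phi y) (phi p).
    apply/safeP; exists phi => // a b; rewrite !inE.
    by do 2!case/orP => /eqP ->.
  (* Move [p] to the branch set of [y]. Its neighbours in the old branch set are [u] and [q], which
     are adjacent, so [q] replaces [p]. *)
  apply/safeP; eexists;
    first apply: (@model_move _ _ _ _ g_sym g_irr h_irr phi p q y) => //.
  - by apply: C.
  - move=> x /np[]->; [by right; rewrite g_sym | by left | ].
    by move/eqP; rewrite (negPf yp).
  - by move=> x /np[]->; [left | left | right]; rewrite // (C _ p).
  have psi x : x \in [set p; y] -> (if x == p then phi y else phi x) = phi y.
    by rewrite !inE => /orP[]/eqP->; rewrite ?eqxx //; case: ifP.
  by move=> a b /psi-> /psi->.
apply: contraT => /(not_ctr3 (edge_neq py))[A [sA pA yA]].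
have [[a aA pa] [b bA pb]] := nbh_side g_sym g_con3 sA pA.
have yF : y \notin far g A by rewrite in_far yA andbF.
have nE x : g p x -> x != y -> x = u \/ x = q.
  rewrite -in_nb Np !inE => /orP[/orP[]/eqP->|->] //; by [left | right].
have ay : a != y by apply: contraTneq aA => ->; rewrite (nbh_notin yA).
have by' : b != y by apply: contraNneq yF => <-.
have := far_edge aA bA; have aF : a \notin far g A by rewrite in_far aA.
case: (nE a pa ay) => aE; case: (nE b pb by') => bE.
- by rewrite aE -bE bA in aF.
- by rewrite aE bE uq.
- by rewrite aE bE g_sym uq.
by rewrite aE -bE bA in aF.
Qed.

End Keep.

Section Fan.
Variables (V : finType) (g : rel V) (W : finType) (h : rel W).
Hypothesis g_sym : symmetric g.
Hypothesis g_irr : irreflexive g.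
Hypothesis g_con3 : con3 g.
Hypothesis h_irr : irreflexive h.

(** The local structure at an isolated vertex, symmetric under exchanging p, y with q, w. *)
Definition fan (u p q y w : V) : Prop :=
  [/\ nb g p = [set u; q; y], nb g q = [set u; p; w],
      [/\ contractible g h p q, contractible g h p y & contractible g h q w],
        3 < #|nb g u| & uniq [:: u; p; q; y; w]].

Lemma triple_sym (u p q : V) : triple g h u p q -> triple g h u q p.
Proof.
case=> -[up uq pq] p3 q3 s; split=> //; first by split=> //; rewrite g_sym.
by apply: safeS s; apply/subsetP => x; rewrite !inE -!orbA (orbC (x == p)).
Qed.

(** Each degenerate configuration contradicts 3-connectedness or the isolation of [u]: if [u] had
    degree 2, {p, q} would cut it off; if it had degree 3, its third edge would be contractible; if
    [y = w], then {u, y} would cut off {p, q}. *)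
Lemma triple_fan (u p q : V) : isolated g h u -> triple g h u p q ->
  exists y w, fan u p q y w.
Proof.
move=> iu T; have [[up uq pq] p3 q3 s] := T.
have up' := edge_neq g_irr up; have uq' := edge_neq g_irr uq.
have pq' := edge_neq g_irr pq.
have [y Np] : exists y, nb g p = [set u; q; y].
  by apply: set3E p3 _ _ uq'; rewrite in_nb // g_sym.
have [w Nq] : exists w, nb g q = [set u; p; w].
  by apply: set3E q3 _ _ up'; rewrite in_nb // g_sym.
have [_ uy qy] := set3_card p3 Np; have [_ uw pw] := set3_card q3 Nq.
have py : g p y by rewrite -in_nb Np !inE eqxx orbT.
have qw : g q w by rewrite -in_nb Nq !inE eqxx orbT.
have py' := edge_neq g_irr py; have qw' := edge_neq g_irr qw.
have [_ _ _ sT'] := triple_sym T.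
have kpy : contractible g h p y by apply: (contractible_third g_sym g_irr g_con3 h_irr
  up uq pq); rewrite // eq_sym.
have kqw : contractible g h q w.
  by apply: (contractible_third g_sym g_irr g_con3 h_irr uq up _ q3 sT') => //;
    rewrite ?(eq_sym w) // g_sym.
have u4 : 3 < #|nb g u|.
  have u2 : 2 < #|nb g u|.
    rewrite ltnNge; apply/negP => le2.
    have E : nb g u = [set p; q].
      apply/esym/eqP; rewrite eqEcard cards2 pq' le2 andbT.
      by apply/subsetP => x; rewrite !inE => /orP[]/eqP->.
    have : 2 < #|nbh g [set u]|.
      apply: g_con3; apply/set0Pn; first by exists u; rewrite in_set1.
      by exists y; rewrite in_far in_set1 nbh1 // E !inE negb_or ![y == _]eq_sym uy py'
        qy.
    by rewrite nbh1 // E cards2 pq'.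
  rewrite ltn_neqAle u2 andbT; apply: contraTneq (iu) => /esym u3.
  have [t Nu] : exists t, nb g u = [set p; q; t].
    by apply: set3E u3 _ _ pq'; rewrite in_nb.
  have [_ pt qt] := set3_card u3 Nu.
  rewrite negb_forall; apply/existsP; exists t; rewrite negbK.
  (* [contractible_third] is applied with [u] as the cubic vertex of the triangle, making its edge
     to [t] contractible. *)
  have sT : safe g h [set p; u; q].
    by apply: safeS s; apply/subsetP => x; rewrite !inE (orbC (x == u)).
  apply: (contractible_third g_sym g_irr g_con3 h_irr _ pq uq u3 sT);
    rewrite 1?g_sym // 1?eq_sym //.
  by rewrite g_sym -in_nb Nu !inE eqxx orbT.
have yw : y != w.
  apply/eqP => E; rewrite -{}E in Nq.
  have /subsetPn[x xN] : ~~ (nb g u \subset [set p; q; y]).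
    apply: contraL u4 => /subset_leq_card; rewrite -leqNgt => /leq_trans; apply.
    by rewrite -setUA cardsU1 cards2; case: (_ \notin _); case: (_ != _).
  rewrite in_nb in xN; rewrite !inE !negb_or -andbA => /and3P[xp xq xy].
  have xu : x != u by rewrite eq_sym (edge_neq g_irr xN).
  have nA : nbh g [set p; q] \subset [set u; y].
    apply/subsetP => z /nbhP[zA [v vA vz]]; move: zA vA; rewrite !inE negb_or.
    move=> /andP[zp zq] /orP[]/eqP E; move: vz; rewrite E -in_nb ?Np ?Nq !inE.
      by rewrite (negPf zq) orbF.
    by rewrite (negPf zp) orbF.
  suff : 2 < #|nbh g [set p; q]|.
    by rewrite ltnNge (leq_trans (subset_leq_card nA)) // cards2; case: (_ != _).
  apply: g_con3; apply/set0Pn; first by exists p; rewrite !inE eqxx.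
  exists x; rewrite in_far !inE negb_or xp xq /=.
  by apply/negP => /(subsetP nA); rewrite !inE (negPf xu) (negPf xy).
exists y, w; split=> //; last first.
  by rewrite /= !inE !negb_or up' uq' uy uw pq' py' pw qy qw' yw.
split=> //.
rewrite /contractible /= pq /=; apply/andP; split.
  by apply: safeS s; apply/subsetP => x; rewrite !inE => /orP[]->; rewrite ?orbT.
apply: contraT => /(not_ctr3 g_con3 pq')[A [sA pA qA]].
(* With [u] on the side [B], the outer neighbours [y] and [w] are on the other side. Then [B]
   without [u] has at most the neighbours [u] and [t], so [B] is just [u], against its degree. If
   [u] were in the cut, [y] would have to be on both sides. *)
have main B : sep3 g B -> p \in nbh g B -> q \in nbh g B -> u \in B -> False.
  move=> sB pB qB uB; have [_ F0 B3] := sB;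
    have uF : u \notin far g B by rewrite in_far uB.
  have [t NB] := set3E B3 pB qB pq'.
  have qF : q \notin far g B by rewrite in_far qB andbF.
  have pF : p \notin far g B by rewrite in_far pB andbF.
  have yF : y \in far g B.
    have [_ [z zF pz]] := nbh_side g_sym g_con3 sB pB.
    move: pz; rewrite -in_nb Np !inE -orbA => /or3P[]/eqP E; last by rewrite -E.
      by rewrite -E zF in uF.
    by rewrite -E zF in qF.
  have wF : w \in far g B.
    have [_ [z zF qz]] := nbh_side g_sym g_con3 sB qB.
    move: qz; rewrite -in_nb Nq !inE -orbA => /or3P[]/eqP E; last by rewrite -E.
      by rewrite -E zF in uF.
    by rewrite -E zF in pF.
  have B0 : B :\ u = set0.
    apply: (@small_set0 _ g g_con3 (B :\ u) B u t) => //; first exact: subsetDl.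
    apply/subsetP => z /nbhP[zA [x /setD1P[xu xB] xz]].
    have [->|zu] := eqVneq z u; first by rewrite !inE eqxx.
    have zB : z \notin B by move: zA; rewrite in_setD1 zu.
    have := mem_nbh xB xz zB; rewrite NB !inE -orbA => /or3P[]/eqP E.
    - move: xz; rewrite g_sym E -in_nb Np !inE (negPf xu) /= => /orP[]/eqP E'.
        by move: (nbh_notin qB); rewrite -E' xB.
      by move: yF; rewrite in_far -E' xB.
    - move: xz; rewrite g_sym E -in_nb Nq !inE (negPf xu) /= => /orP[]/eqP E'.
        by move: (nbh_notin pB); rewrite -E' xB.
      by move: wF; rewrite in_far -E' xB.
    by rewrite E eqxx orbT.
  have BE : B = [set u] by rewrite -(setD1K uB) B0 setU0.
  by move: u4; rewrite -nbh1 // -BE B3.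
have [sF NF FF] := sep3_far g_sym g_con3 sA.
case: (sideP g A u) => -[u1 u2 u3].
- by case: (main A).
- have [[a aA pa] [b bF pb]] := nbh_side g_sym g_con3 sA pA.
  have nE x : g p x -> x \notin nbh g A -> x = y.
    rewrite -in_nb Np !inE -orbA => /or3P[]/eqP-> //; by rewrite ?u2 ?qA.
  have := nE a pa; have := nE b pb; move: bF; rewrite in_far => /andP[bA bN].
  move=> /(_ bN) E /(_ _) E'; rewrite -E in E'; case/negP: bA; rewrite -E' //.
  by apply: contraL aA; apply: nbh_notin.
by case: (main (far g A)); rewrite ?NF.
Qed.

End Fan.

(** * Contraction *)

(* The graph G/S with the loops removed, presented by its projection. *)
Definition contraction (V V' : finType) (g : rel V) (g' : rel V') (f : V -> V')
    (S : {set V}) : Prop :=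
  [/\ forall a, exists x, f x = a,
      forall x y, f x = f y -> x = y \/ (x \in S /\ y \in S),
      forall x y, x \in S -> y \in S -> f x = f y &
      forall a b, g' a b <-> a != b /\ exists x y, [/\ f x = a, f y = b & g x y]].

Section Contraction.
Variables (V V' : finType) (g : rel V) (g' : rel V') (f : V -> V') (S : {set V}).
Variables (W : finType) (h : rel W).
Hypothesis fC : contraction g g' f S.
Hypothesis g_sym : symmetric g.
Hypothesis g_irr : irreflexive g.
Hypothesis g_con3 : con3 g.
Hypothesis h_irr : irreflexive h.
Hypothesis S_conn : conn g S.

Let f_surj a : exists x, f x = a. Proof. by case: fC. Qed.
Let f_ker x y : f x = f y ->
  x = y \/ (x \in S /\ y \in S). Proof. by case: fC => _ H _ _; apply: H. Qed.
Let f_S x y : x \in S -> y \in S -> f x = f y. Proof. by case: fC => _ _ H _;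
  apply: H. Qed.

Lemma ct_edge (x y : V) : g x y -> f x != f y -> g' (f x) (f y).
Proof. by case: fC => _ _ _ E xy n; apply/E; split=> //; exists x, y. Qed.

Lemma ct_edgeP (a b : V') : g' a b -> a != b /\ exists x y, [/\ f x = a, f y = b & g x y].
Proof. by case: fC => _ _ _ E /E. Qed.

Lemma ct_sym : symmetric g'.
Proof.
have H a b : g' a b -> g' b a.
  move=> /ct_edgeP[ab [x [y [xa yb xy]]]].
  by rewrite -xa -yb; apply: ct_edge; rewrite ?xa ?yb 1?eq_sym // g_sym.
by move=> a b; apply/idP/idP; apply: H.
Qed.

Lemma ct_irr : irreflexive g'.
Proof. by move=> a; apply/negP => /ct_edgeP[]; rewrite eqxx. Qed.

Lemma ct_conn (F : {set V'}) : conn g' F -> conn g (f @^-1: F).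
Proof.
move=> cF; have [->|[a0 a0F]] := set_0Vmem F.
  by rewrite preimset0; apply/forall_inP => x; rewrite inE.
have [x0 x0a] := f_surj a0.
apply: (@conn_root _ _ g_sym _ x0) => X x clX xQ xX.
have sat y z : f y = f z -> y \in f @^-1: F -> y \in X -> z \in X.
  move=> yz yQ yX; case: (f_ker yz) => [<-//|[yS zS]].
  apply: (conn_closed S_conn _ yS zS yX) => c d cS dS; apply: clX.
    by move: yQ; rewrite !inE (f_S cS yS).
  by move: yQ; rewrite !inE (f_S dS yS).
have : a0 \in f @: (X :&: f @^-1: F).
  have fx : f x \in f @: (X :&: f @^-1: F) by apply: imset_f; rewrite in_setI xX.
  have fxQ : f x \in F by move: xQ; rewrite inE.
  apply: (conn_closed cF _ fxQ a0F fx) => c d.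
  move=> cF' dF /imsetP[y /setIP[yX yQ] E] /ct_edgeP[cd [z [z' [zc z'd zz']]]].
  have zX : z \in X by apply: sat yX; rewrite // -E zc.
  rewrite -z'd; apply: imset_f; rewrite in_setI inE z'd dF andbT.
  by apply: clX zX zz'; rewrite inE ?zc ?z'd.
by case/imsetP => y /setIP[yX yQ] E; apply: sat yX; rewrite // x0a.
Qed.

Lemma ct_pull (phi' : V' -> W) : model g' h phi' -> model g h (phi' \o f).
Proof.
move=> /modelP[surj con edges]; apply/modelP; split.
- by move=> w; have [a aw] := surj w; have [x xa] := f_surj a; exists x; rewrite /= xa.
- move=> w; suff -> : fibre (phi' \o f) w = f @^-1: fibre phi' w by apply/ct_conn/con.
  by apply/setP => x; rewrite !inE.
move=> a b ab; have [c [d [ca db cd]]] := edges a b ab.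
have [_ [x [y [xc yd xy]]]] := ct_edgeP cd.
by exists x, y; rewrite /= xc yd.
Qed.

Lemma ct_safe (A : {set V'}) : safe g' h A -> safe g h (f @^-1: A).
Proof.
case/safeP => phi M C; apply/safeP; exists (phi \o f); first exact: ct_pull.
by move=> x y; rewrite !inE; apply: C.
Qed.

Lemma ct_push (phi : V -> W) : model g h phi ->
  (forall x y, x \in S -> y \in S -> phi x = phi y) ->
  exists2 phi' : V' -> W, model g' h phi' & phi' \o f =1 phi.
Proof.
move=> /modelP[surj con edges] C.
have [l lK] : exists l, forall a,
  f (l a) = a by apply: (@fin_all_exists _ _ (fun a x => f x = a)).
have lE x : phi (l (f x)) = phi x by case: (f_ker (lK (f x))) => [->//|[]]; apply: C.
exists (phi \o l); last exact: lE.
apply/modelP; split.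
- by move=> w; have [x xw] := surj w; exists (f x); rewrite /= lE.
- move=> w; have [x0 x0w] := surj w.
  apply: (@conn_root _ _ ct_sym _ (f x0)) => X a clX aQ aX.
  have : x0 \in f @^-1: X.
    have laQ : l a \in fibre phi w by move: aQ; rewrite !in_fibre.
    have x0Q : x0 \in fibre phi w by rewrite in_fibre x0w.
    have laX : l a \in f @^-1: X by rewrite inE lK.
    apply: (conn_closed (con w) _ laQ x0Q laX) => c d.
    rewrite !in_fibre !inE => cw dw cX cd.
    have [<-//|cd'] := eqVneq (f c) (f d).
    by apply: clX cX (ct_edge cd cd'); rewrite in_fibre /= lE.
  by rewrite inE.
move=> a b ab; have [x [y [xa yb xy]]] := edges a b ab.
exists (f x), (f y); rewrite /= !lE; split=> //; apply: ct_edge => //.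
apply: contraTneq ab => E; have : phi x = phi y by rewrite -lE E lE.
by rewrite xa yb => ->; rewrite h_irr.
Qed.

Lemma ct_nbh (A : {set V}) : (forall x y, f x = f y -> x \in A -> y \in A) ->
  nbh g' (f @: A) = f @: nbh g A.
Proof.
move=> sat; apply/setP => b; apply/nbhP/imsetP => [[bA [a /imsetP[x0 x0A E] ab]]|].
  have [_ [x [y [xa yb xy]]]] := ct_edgeP ab.
  have xA : x \in A by apply: sat x0A; rewrite xa E.
  exists y => //; apply: mem_nbh xA xy _; apply: contra bA => yA.
  by rewrite -yb imset_f.
case=> y yN ->; case/nbhP: (yN) => yA [x xA xy]; split.
  by apply: contra yA => /imsetP[z zA E]; apply: sat zA; rewrite E.
exists (f x); first exact: imset_f.
by apply: ct_edge => //; apply: contra yA => /eqP E; apply: sat xA.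
Qed.

(** Pull the set back. If its neighbourhood avoids [S], it maps injectively and keeps three
    vertices; if it meets [S], the merged vertex counts once and [ctr3] gives two more. *)
Lemma ct_con3 : ctr3 g S -> con3 g'.
Proof.
move=> cS A' /set0Pn[a aA'] /set0Pn[b bF].
pose A := f @^-1: A'.
have sat x y : f x = f y -> x \in A -> y \in A by rewrite !inE => ->.
have fA : f @: A = A'.
  apply/setP => c; apply/imsetP/idP => [[x]|cA]; first by rewrite inE => xA ->.
  by have [x xc] := f_surj c; exists x; rewrite ?inE xc.
have [x xa] := f_surj a; have [y yb] := f_surj b.
have xA : x \in A by rewrite inE xa.
have A0 : A != set0 by apply/set0Pn; exists x.
have NE := ct_nbh sat; rewrite fA in NE.
move: bF; rewrite in_far NE => /andP[bA bN].
have yA : y \notin A by rewrite inE yb.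
have yN : y \notin nbh g A by apply: contra bN => yN; rewrite -yb imset_f.
have N3 : 2 < #|nbh g A|.
  by apply: g_con3 => //; apply/set0Pn; exists y; rewrite in_far yA.
have [dis|] := boolP [disjoint nbh g A & S].
  rewrite card_in_imset // => c d cN dN /f_ker[//|[cS' _]].
  by move/pred0P/(_ c): dis; rewrite /= cN cS'.
case/pred0Pn => s /= /andP[sN sS].
have dAS : [disjoint A & S].
  apply/pred0P => c /=; apply/negP => /andP[cA cS'].
  by case/negP: (nbh_notin sN); apply: sat cA; apply: f_S.
have yS : y \notin S.
  by apply: contra bN => yS; rewrite -yb (f_S yS sS) imset_f.
have := ctr3P cS A0 dAS yA yN yS.
have inj : {in nbh g A :\: S &, injective f}.
  by move=> c d /setDP[_ cS'] _ /f_ker[//|[]]; rewrite (negPf cS').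
rewrite -(card_in_imset inj) => le2.
apply: (@leq_trans #|f s |: f @: (nbh g A :\: S)|).
  rewrite cardsU1; suff -> : f s \notin f @: (nbh g A :\: S) by [].
  apply/negP => /imsetP[c /setDP[cN cS'] /f_ker[E|[_]]]; last by rewrite (negPf cS').
  by rewrite -E sS in cS'.
apply: subset_leq_card; apply/subsetP => c /setU1P[->|/imsetP[d /setDP[dN _] ->]];
exact: imset_f.
Qed.

(* The clique S meets at most one side of a 3-cut around a b; the other side
   survives in G/S, where only two vertices of the cut remain once a b is
   contracted, so the side meeting S must be swallowed by S. *)
Lemma ct_contractible (a b : V) : (forall x y, x \in S -> y \in S -> x != y -> g x y) ->
  g a b -> contractible g' h (f a) (f b) ->
  contractible g h a b \/
  exists A x, [/\ sep3 g A, A \subset S, a \in nbh g A,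
    b \in nbh g A & x \in S :&: nbh g A].
Proof.
move=> clique ab /and3P[ab' s' c'].
have s : safe g h [set a; b].
  by apply: safeS (ct_safe s'); apply/subsetP => x; rewrite !inE => /orP[]/eqP->;
    rewrite eqxx ?orbT.
have [cab|/(not_ctr3 g_con3 (edge_neq g_irr ab))[A [sA aA bA]]] := boolP (ctr3 g [set
  a; b]).
  by left; rewrite /contractible /= ab s cab.
right; have main B : sep3 g B -> a \in nbh g B -> b \in nbh g B -> [disjoint B & S] ->
    exists A x, [/\ sep3 g A, A \subset S, a \in nbh g A,
      b \in nbh g A & x \in S :&: nbh g A].
  move=> sB aB bB dis; have [sF NF FF] := sep3_far g_sym g_con3 sB.
  have [B0 /set0Pn[y0 y0F] B3] := sB.
  have dS x : x \in B -> x \notin S.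
    by move=> xB; apply/negP => xS; move/pred0P/(_ x): dis; rewrite /= xB xS.
  have sat x y : f x = f y -> x \in B -> y \in B.
    by move=> /f_ker[<-//|[xS _]] xB; rewrite (negPf (dS x xB)) in xS.
  (* Such a [y] stays off the image of the cut, so after contracting the image of a b the set
     [f @: B] would be separated from it by the image of [t] and the merged vertex alone. *)
  have key y : y \in far g B -> (y \in S -> S :&: nbh g B = set0) -> False.
    move=> yF yS; move: (yF); rewrite in_far => /andP[yB yN].
    have nin : f y \notin f @: nbh g B.
      apply/imsetP => -[z zN /f_ker[E|[yS' zS]]]; first by rewrite E zN in yN.
      by move/setP/(_ z): (yS yS'); rewrite in_setI zS zN inE.
    have nab c : c \in nbh g B -> f y != f c.
      by move=> cN; apply: contraNneq nin => ->; apply: imset_f.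
    have [t NB] := set3E B3 aB bB (edge_neq g_irr ab).
    have : 1 < #|nbh g' (f @: B) :\: [set f a; f b]|.
      apply: (@ctr3P _ _ _ _ (f y) c').
      - by case/set0Pn: B0 => x xB; apply/set0Pn; exists (f x); apply: imset_f.
      - apply/pred0P => c /=; apply/negP => /andP[/imsetP[x xB ->]].
        rewrite !inE => /orP[]/eqP /sat/(_ xB);
          by rewrite ?(negPf (nbh_notin aB)) ?(negPf (nbh_notin bB)).
      - by apply: contra yB => /imsetP[x xB E]; apply: sat xB.
      - by rewrite ct_nbh.
      by rewrite !inE negb_or !nab.
    rewrite ct_nbh // ltnNge => /negP; apply.
    rewrite -(cards1 (f t)); apply: subset_leq_card;
      apply/subsetP => c /setDP[/imsetP[x xN ->]].
    rewrite NB !inE -orbA in xN; case/or3P: xN => /eqP->; by rewrite !inE ?eqxx ?orbT.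
  have FS : far g B \subset S.
    by apply/subsetP => y yF; apply: contraT => yS; case: (key y yF); rewrite (negPf yS).
  have /set0Pn[x xI] : S :&: nbh g B != set0.
    by apply/eqP => E; apply: (key y0 y0F).
  by exists (far g B), x; rewrite NF.
have [dis|] := boolP [disjoint A & S]; first exact: main sA aA bA dis.
case/pred0Pn => x /= /andP[xA xS]; have [sF NF FF] := sep3_far g_sym g_con3 sA.
apply: (main (far g A)); rewrite ?NF //; apply/pred0P => y /=; apply/negP => /andP[yF yS].
have := far_edge xA yF; rewrite clique //; apply: contraTneq yF => <-.
by rewrite in_far xA.
Qed.

End Contraction.

Section Canonical.
Variables (V : finType) (g : rel V) (S : {set V}) (s : V).
Hypothesis sS : s \in S.

(** The vertex [s] stands for all of [S] and other vertices keep their names, so [val] is a section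
    of the projection. *)
Definition ct_pred (x : V) : bool := (x == s) || (x \notin S).
Definition ct_type : finType := {x : V | ct_pred x}.

Lemma ct_funP (x : V) : ct_pred (if x \in S then s else x).
Proof. by rewrite /ct_pred; case: ifP => [_|->]; rewrite ?eqxx ?orbT. Qed.

Definition ct_fun (x : V) : ct_type := exist ct_pred _ (ct_funP x).

Definition ct_rel : rel ct_type := [rel a b | (a != b) &&
  [exists x, exists y, [&& ct_fun x == a, ct_fun y == b & g x y]]].

Lemma ct_fun_val (a : ct_type) : ct_fun (val a) = a.
Proof.
apply: val_inj => /=; case: ifP => // aS.
by case/orP: (valP a) => [/eqP->//|]; rewrite aS.
Qed.

Lemma ct_contraction : contraction g ct_rel ct_fun S.
Proof.
split.
- by move=> a; exists (val a); rewrite ct_fun_val.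
- move=> x y /(congr1 val) /=; case: ifP => xS; case: ifP => yS E; rewrite -?E ?xS;
  try by [left | right].
  + by rewrite -E sS in yS.
  by rewrite E sS in xS.
- by move=> x y xS yS; apply: val_inj; rewrite /= xS yS.
move=> a b; split.
  by case/andP => ab /existsP[x /existsP[y /and3P[/eqP xa /eqP yb xy]]]; split=> //;
    exists x, y.
case=> ab [x [y [xa yb xy]]]; rewrite /ct_rel /= ab /=.
by apply/existsP; exists x; apply/existsP; exists y; rewrite xa yb !eqxx.
Qed.

Lemma card_ct : #|ct_type| = #|V| - #|S| + 1.
Proof.
have E : #|[pred x | ct_pred x]| = #|s |: ~: S| by apply: eq_card => x; rewrite !inE.
by rewrite card_sig E cardsU1 in_setC sS cardsCs setCK addnC.
Qed.

End Canonical.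

(** * Dominating sets and components *)

Section Domination.
Variables (V : finType) (e : rel V).

(* The size of a dominating set bounds the number of components of [e]. *)
Definition dominates (R : {set V}) : Prop :=
  forall v, exists2 r, r \in R & connect e v r.

(** One root per component. A chosen neighbour of each non-isolated root is not a root and
    determines its root, so the roots outside the isolated set are counted twice within V. *)
Lemma dominating_roots : symmetric e -> irreflexive e ->
  exists2 R, dominates R & 2 * #|R| <= #|V| + #|[set u | [forall v, ~~ e u v]]|.
Proof.
move=> e_sym e_irr; have c_sym : connect_sym e by apply: sym_connect_sym.
set U := [set u | _]; pose R := [set x | roots e x].
exists R => [v|]; first by exists (root e v); rewrite ?inE ?roots_root ?connect_root.
pose f x := odflt x [pick y | e x y].
have fE x : x \notin U -> e x (f x).
  rewrite inE negb_forall => /existsP[y]; rewrite negbK => xy.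
  by rewrite /f; case: pickP => [//|/(_ y)]; rewrite xy.
have rf x : x \in R -> x \notin U -> root e (f x) = x.
  move=> xR xU; move: xR; rewrite inE => /eqP xr; rewrite -[RHS]xr.
  by apply/esym/(rootP c_sym)/connect1/fE.
have inj : {in R :\: U &, injective f}.
  by move=> x y /setDP[xR xU] /setDP[yR yU] E; rewrite -(rf x) // E rf.
have dis : [disjoint R & f @: (R :\: U)].
  apply/pred0P => z /=; apply/negP => /andP[zR /imsetP[x /setDP[xR xU] E]].
  have zz : root e z = z by apply/eqP; move: zR; rewrite inE.
  have xz := fE x xU; have := rf x xR xU; rewrite -E zz => zx.
  by rewrite -E zx e_irr in xz.
have := cardsUI R (f @: (R :\: U)).
rewrite disjoint_setI0 // cards0 addn0 card_in_imset //.
have m : #|R :|: f @: (R :\: U)| <= #|V| := max_card _.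
have d := cardsID U R; have i := subset_leq_card (subsetIr R U); lia.
Qed.

Variables (V' : finType) (e' : rel V') (f : V -> V') (P : pred V).

(** Lifts of consecutive edges may end at different preimages of the same vertex, which the first
    hypothesis joins within the fibre. The predicate [P] excludes the isolated vertex [u], for which
    this fails when u p q is contracted. *)
Lemma connect_lift :
  (forall x y, P x -> P y -> f x = f y -> connect e x y) ->
  (forall a b, e' a b -> exists x y, [/\ P x, P y, f x = a, f y = b & connect e x y]) ->
  forall x y, P x -> P y -> connect e' (f x) (f y) -> connect e x y.
Proof.
move=> ker edge x y Px Py /connectP[s]; elim: s x Px => [|b s IH] x Px /=.
  by move=> _ E; apply: ker.
case/andP => /edge[z [z' [Pz Pz' zx zb zz']]] ps E.
apply: connect_trans (ker _ _ Px Pz (esym zx)) (connect_trans zz' _).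
by apply: IH; rewrite // zb.
Qed.

End Domination.

(** * Lifting contractible edges from a contraction *)

Section Step.
Variables (V V' : finType) (g : rel V) (g' : rel V') (f : V -> V').
Variables (W : finType) (h : rel W).
Hypothesis g_sym : symmetric g.
Hypothesis g_irr : irreflexive g.
Hypothesis g_con3 : con3 g.
Hypothesis h_irr : irreflexive h.

Lemma fan_sym (u p q y w : V) : fan g h u p q y w -> fan g h u q p w y.
Proof.
case=> Np Nq [pq py qw] u4 yw; split=> //; first by split=> //; rewrite contractible_sym.
by rewrite (@perm_uniq _ _ [:: u; p; q; y; w]) //; apply/permP => a /=; lia.
Qed.

Lemma in3 (a b c x : V) : (x \in [set a; b; c]) = [|| x == a, x == b | x == c].
Proof. by rewrite !inE -orbA. Qed.

Lemma nbP (a b c v : V) : nb g v = [set a; b; c] ->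
  forall x, g v x = [|| x == a, x == b | x == c].
Proof. by move=> E x; rewrite -in_nb E in3. Qed.

(** G/upq arises from G/pq by contracting the image of u p. *)
Lemma ctr3_triangle (u p q : V) :
  contraction g g' f [set p; q] -> u != p -> u != q -> ctr3 g' [set f p; f u] ->
  ctr3 g [set u; p; q].
Proof.
move=> C up uq cT; have ker := let: And4 _ k _ _ := C in k.
have pqE : f p = f q by case: C => _ _ H _; apply: H; rewrite !inE eqxx ?orbT.
apply/forallP => A; apply/implyP => /and3P[A0 dis full].
have dA x : x \in A -> x \notin [set u; p; q].
  by move=> xA; apply/negP => xS; move/pred0P/(_ x): dis; rewrite /= xA xS.
have dS x : x \notin [set u; p; q] -> x \notin [set p; q].
  by rewrite in3 !inE !negb_or => /and3P[_ -> ->].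
have ker' x y : x \notin [set p; q] -> f x = f y -> x = y.
  by move=> xS /ker[//|[]]; rewrite (negPf xS).
have /set0Pn[x] : ~: (A :|: nbh g A :|: [set u; p; q]) != set0.
  by apply: contraNneq full => E; rewrite -[_ :|: _]setCK E setC0.
rewrite in_setC !in_setU !in_set1 !negb_or -!andbA => /and5P[xA xN xu xp xq].
have xS : x \notin [set p; q] by rewrite !inE negb_or xp.
have NE : nbh g' (f @: A) = f @: nbh g A.
  by apply: (ct_nbh C) => v z E vA; rewrite -(ker' v z) // dS // dA.
have fx (B : {set V}) : x \notin B -> f x \notin f @: B.
  by move=> xB; apply/imsetP => -[z zB /(ker' x z xS) E]; rewrite E zB in xB.
have : 1 < #|nbh g' (f @: A) :\: [set f p; f u]|.
  apply: (@ctr3P _ _ _ _ (f x) cT); rewrite ?NE ?fx //.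
  - by case/set0Pn: A0 => z zA; apply/set0Pn; exists (f z); apply: imset_f.
  - apply/pred0P => c /=; apply/negP => /andP[/imsetP[z zA ->]].
    have := dA z zA; rewrite in3 !inE !negb_or => /and3P[zu zp zq].
    have zS : z \notin [set p; q] by rewrite !inE negb_or zp.
    by case/orP => /eqP/(ker' _ _ zS) E; [rewrite E eqxx in zp | rewrite E eqxx in zu].
  rewrite !inE negb_or; apply/andP; split; apply/eqP => /(ker' _ _ xS) E.
    by rewrite E eqxx in xp.
  by rewrite E eqxx in xu.
move/leq_trans; apply; apply: leq_trans (leq_imset_card f _).
apply: subset_leq_card; apply/subsetP => c; rewrite NE => /setDP[/imsetP[z zN ->]] zT.
apply: imset_f; rewrite in_setD zN andbT in3; apply: contra zT.
by case/or3P => /eqP->; rewrite !inE -?pqE ?eqxx ?orbT.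
Qed.

Lemma fan_edges (u p q y w : V) : fan g h u p q y w ->
  [/\ [/\ g u p, g u q & g p q], g p y, g q w, #|nb g p| = 3 & #|nb g q| = 3].
Proof.
move=> [Np Nq [kpq kpy kqw] u4]; rewrite /= !inE !negb_or -!andbA.
case/and5P => up uq uy uw /and5P[pq py pw qy /and3P[qw yw _]].
have [gpq gpy gqw] : [/\ g p q, g p y & g q w].
  by case/and3P: kpq; case/and3P: kpy; case/and3P: kqw.
split=> //; last 2 first.
- by rewrite Np -setUA cardsU1 cards2 !inE negb_or uq uy qy.
- by rewrite Nq -setUA cardsU1 cards2 !inE negb_or up uw pw.
by split=> //; rewrite g_sym ?(nbP Np) ?(nbP Nq) eqxx.
Qed.

(** Apart from [q], the vertex [p] has only the neighbours [u] and [y]. Once these are identified it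
    makes no difference, up to loops and parallel edges, whether [p] is merged with [q] or with
    them. *)
Lemma ctr3_next (u p q y w : V) : fan g h u p q y w ->
  contraction g g' f [set p; q] -> ctr3 g' [set f u; f y] -> ctr3 g [set u; p; y].
Proof.
move=> F C cT; have [[gup guq gpq] gpy gqw p3 q3] := fan_edges F.
have [Np Nq _ u4] := F; rewrite /= !inE !negb_or -!andbA.
case/and5P => up uq uy uw /and5P[pq py pw qy /and3P[qw yw _]].
have ker := let: And4 _ k _ _ := C in k.
apply/forallP => A; apply/implyP => /and3P[A0 dis full].
have /set0Pn[x] : ~: (A :|: nbh g A :|: [set u; p; y]) != set0.
  by apply: contraNneq full => E; rewrite -[_ :|: _]setCK E setC0.
rewrite in_setC !in_setU !in_set1 !negb_or -!andbA => /and5P[xA xN xu xp xy].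
have dA v : v \in [set u; p; y] -> v \notin A.
  by move=> vT; apply/negP => vA; move/pred0P/(_ v): dis; rewrite /= vA vT.
have [uA pA yA] : [/\ u \notin A, p \notin A & y \notin A].
  by split; apply: dA; rewrite in3 eqxx ?orbT.
have uS : u \notin [set p; q] by rewrite !inE negb_or up.
have yS : y \notin [set p; q] by rewrite !inE negb_or eq_sym py eq_sym.
have ker' v z : v \notin [set p; q] -> f z = f v -> z = v.
  by move=> vS /ker[//|[_]]; rewrite (negPf vS).
(* The projection identifies [p] and [q], so [A] is completed to a union of fibres; the only
   neighbours this can add are [u] and [y]. *)
pose B := if q \in A then p |: A else A.
have AB : A \subset B by rewrite /B; case: ifP => // _; apply: subsetUr.
have BA z : z \in B -> z \in A \/ z = p.
  by rewrite /B; case: ifP => _; [case/setU1P; [right|left] | left].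
have pB : (p \in B) = (q \in B).
  rewrite /B; case: ifP => qA; rewrite ?qA ?in_setU1 ?eqxx ?qA ?orbT //.
  by rewrite (negPf pA).
have sat v z : f v = f z -> v \in B -> z \in B.
  by move/ker => [->//|[]]; rewrite !inE => /orP[]/eqP-> /orP[]/eqP->; rewrite ?pB.
have NB z : z \in nbh g B -> z \in nbh g A :\: [set u; p; y] \/ z = u \/ z = y.
  case/nbhP => zB [v vB vz]; have [vA|vp] := BA v vB.
    have zA : z \notin A by apply: contra zB; apply: (subsetP AB).
    have zN := mem_nbh vA vz zA; rewrite in_setD zN andbT in3.
    have [->|zu] := eqVneq z u; first by right; left.
    have [->|zy] := eqVneq z y; first by right; right.
    left; rewrite orbF; apply: contra zB => /eqP E.
    rewrite E pB; apply: (subsetP AB).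
    move: vz; rewrite E g_sym (nbP Np) => /or3P[]/eqP E'.
    - by rewrite -E' vA in uA.
    - by rewrite -E'.
    by rewrite -E' vA in yA.
  move: vz; rewrite vp (nbP Np) => /or3P[]/eqP E; [by right; left | | by right; right].
  by rewrite E -pB -vp vB in zB.
have xB : x \notin B by apply/negP => /BA[]; [apply/negP | apply/eqP].
have NE := ct_nbh C sat.
have pqT z : z \in [set p; q] -> f z <> f u /\ f z <> f y.
  move=> zS; split=> /esym /ker[E|[]]; rewrite ?(negPf uS) ?(negPf yS) //.
    by rewrite E zS in uS.
  by rewrite E zS in yS.
have xfN : f x \notin f @: nbh g B.
  apply/imsetP => -[z /NB zN E]; have [xz|[xS zS]] := ker x z E.
    move: zN; rewrite -xz in_setD (negPf xN) andbF => -[//|[]E']; by move: xu xy;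
      rewrite E' eqxx.
  case: zN => [/setDP[zN]|[]zE]; last 2 first.
  - by rewrite zE (negPf uS) in zS.
  - by rewrite zE (negPf yS) in zS.
  rewrite in3 !negb_or => /and3P[_ zp _].
  move: xS zS; rewrite !inE (negPf xp) (negPf zp) /= => /eqP xq /eqP zq.
  by rewrite zq -xq (negPf xN) in zN.
have : 1 < #|nbh g' (f @: B) :\: [set f u; f y]|.
  apply: (@ctr3P _ _ _ _ (f x) cT); rewrite ?NE //.
  - case/set0Pn: A0 => z zA; apply/set0Pn; exists (f z); apply: imset_f.
    exact: (subsetP AB).
  - apply/pred0P => c /=; apply/negP => /andP[/imsetP[z zB ->]].
    case/set2P => E; case: (BA _ (sat _ _ E zB)) => [|/eqP];
      by rewrite ?(negPf uA) ?(negPf yA) ?(negPf up) // eq_sym (negPf py).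
  - by apply/imsetP => -[z zB /esym E]; rewrite (sat _ _ E zB) in xB.
  rewrite !inE negb_or; apply/andP; split.
    by apply/eqP => /(ker' _ _ uS)/eqP; rewrite (negPf xu).
  by apply/eqP => /(ker' _ _ yS)/eqP; rewrite (negPf xy).
move/leq_trans; apply; apply: leq_trans (leq_imset_card f _).
apply: subset_leq_card; apply/subsetP => c; rewrite NE => /setDP[/imsetP[z zN ->]].
rewrite !inE negb_or => /andP[zu zy]; apply: imset_f.
by case: (NB z zN) => [//|[]E]; [rewrite E eqxx in zu | rewrite E eqxx in zy].
Qed.

(** A model of G/pq that merges u and y pulls back to G, where [p] can be moved from the branch set
    of [q] to that of [u]. That [y] is cubic follows from the 3-cut around the edge u p. *)
Lemma triple_next (u p q y w : V) : isolated g h u -> fan g h u p q y w ->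
  contraction g g' f [set p; q] -> g u y -> contractible g' h (f u) (f y) ->
  triple g h u p y /\ ctr3 g [set u; p; y].
Proof.
move=> iu F C guy /and3P[_ s' c']; have cT := ctr3_next F C c'.
have [[gup guq gpq] gpy gqw p3 q3] := fan_edges F.
have [Np Nq _ u4] := F; rewrite /= !inE !negb_or -!andbA.
case/and5P => up uq uy uw /and5P[pq py pw qy /and3P[qw yw _]].
have cS : conn g [set p; q].
  apply: (@conn_root _ _ g_sym _ p) => X x clX /set2P[->//|->] qX.
  by apply: clX qX _; rewrite ?inE ?eqxx ?orbT // g_sym.
have sT : safe g h [set u; p; y].
  case/safeP: s' => phi' M' C'; have M := ct_pull C g_sym cS M'.
  set phi := phi' \o f in M.
  have pqE : phi p = phi q.
    by case: C => _ _ H _; congr phi'; apply: H; rewrite !inE eqxx ?orbT.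
  have uyE : phi u = phi y by apply: C'; rewrite !inE eqxx ?orbT.
  have [puE|puE] := eqVneq (phi p) (phi u).
    apply/safeP; exists phi => // a b; rewrite !in3.
    by case/or3P => /eqP->; case/or3P => /eqP->; rewrite ?puE ?uyE.
  have M2 : model g h (fun x => if x == p then phi u else phi x).
    apply: (@model_move _ _ _ _ g_sym g_irr h_irr phi p q u) => //.
    - by rewrite g_sym.
    - move=> x; rewrite (nbP Np) => /or3P[]/eqP->; [ | by left | ].
        by move/eqP; rewrite eq_sym (negPf puE).
      by move/eqP; rewrite -uyE eq_sym (negPf puE).
    by move=> x; rewrite (nbP Np) => /or3P[]/eqP->; [right | left | right].
  apply/safeP; eexists; first exact: M2.
  have E x : x \in [set u; p; y] -> (if x == p then phi u else phi x) = phi u.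
    by rewrite in3 => /or3P[]/eqP->; case: ifP => // /eqP; rewrite ?uyE.
  by move=> a b /E-> /E->.
split=> //; split=> //; rewrite -nbh1 //.
have sup : safe g h [set u; p].
  by apply: safeS sT; apply/subsetP => x; rewrite !inE => ->.
have [A [sA uA pA]] := isolated_sep g_irr g_con3 iu gup sup.
have [sF NF FF] := sep3_far g_sym g_con3 sA.
have main B : sep3 g B -> u \in nbh g B -> p \in nbh g B -> y \in B ->
  #|nbh g [set y]| = 3.
  move=> sB uB pB yB; have [sFB NFB FFB] := sep3_far g_sym g_con3 sB.
  have [B0 F0 B3] := sB; have [t NB] := set3E B3 uB pB up.
  (* Any other vertex of [B] would survive the contraction of {u, p, y} and be separated from the
     far side by the merged vertex and [t]. *)
  suff BE : B = [set y] by rewrite -BE.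
  apply/eqP; rewrite eqEsubset sub1set yB andbT; apply/subsetP => x xB.
  have yF : y \notin far g B by rewrite in_far yB.
  apply: contraT => xy.
  have : 1 < #|nbh g (far g B) :\: [set u; p; y]|.
    apply: (@ctr3P _ _ _ _ x cT) => //.
    - apply/pred0P => z /=; apply/negP => /andP[zF]; rewrite in3 => /or3P[]/eqP E;
      rewrite E in zF.
      + by rewrite in_far uB andbF in zF.
      + by rewrite in_far pB andbF in zF.
      by rewrite zF in yF.
    - by rewrite in_far xB.
    - by rewrite NFB; apply: contraL xB; apply: nbh_notin.
    rewrite in_set1 in xy; rewrite in3 !negb_or xy andbT; apply/andP; split.
      by apply: contraTneq xB => ->; rewrite (nbh_notin uB).
    by apply: contraTneq xB => ->; rewrite (nbh_notin pB).
  rewrite NFB NB ltnNge => /negP[]; rewrite -(cards1 t); apply: subset_leq_card.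
  by apply/subsetP => z;
    rewrite in_setD !in3 in_set1 !negb_or -!andbA => /and4P[/negPf-> /negPf-> _].
(* Otherwise [q] would be the only neighbour of [p] off the cut, although [p] has neighbours on both
   sides. *)
have yN : y \notin nbh g A.
  have [[a aA pa] [b bF pb]] := nbh_side g_sym g_con3 sA pA.
  apply/negP => yA.
  have nE x : g p x -> x \notin nbh g A -> x = q.
    by rewrite (nbP Np) => /or3P[]/eqP->; rewrite ?uA ?yA.
  move: (bF); rewrite in_far => /andP[bA bN].
  have aN : a \notin nbh g A by apply: contraL aA; apply: nbh_notin.
  by rewrite (nE b pb bN) -(nE a pa aN) aA in bA.
case: (sideP g A y) => -[y1 y2 y3]; first exact: main sA uA pA y1.
  by rewrite y2 in yN.
by apply: (main (far g A)); rewrite ?NF.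
Qed.

(** The exceptional case of [ct_contractible] with cut side {p}, where both ends are among u, q, y.
    The edge u q would make G/upq 3-connected, u y would make u p y a contractible triangle by
    [triple_next], and q y is not an edge. *)
Lemma edge_lift_pair (u p q y w a b : V) :
  isolated g h u -> fan g h u p q y w -> triple g h u p q ->
  contraction g g' f [set p; q] ->
  (forall p q, triple g h u p q -> ~~ ctr3 g [set u; p; q]) ->
  g a b -> contractible g' h (f a) (f b) -> g p a -> g p b -> False.
Proof.
move=> iu F T C nT; have [[gup guq gpq] gpy gqw p3 q3] := fan_edges F.
have [Np Nq _ u4] := F; rewrite /= !inE !negb_or -!andbA.
case/and5P => up uq uy uw /and5P[pq py pw qy /and3P[qw yw _]].
have pqE : f p = f q by case: C => _ _ H _; apply: H; rewrite !inE eqxx ?orbT.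
have g'_sym := ct_sym C g_sym.
have gqy : g q y = false.
  by rewrite (nbP Nq) ![y == _]eq_sym (negPf uy) (negPf py) eq_sym (negPf yw).
have kq : contractible g' h (f u) (f q) -> False.
  case/and3P => _ _ c; case/negP: (nT p q T); apply: (ctr3_triangle C up uq).
  by rewrite pqE setUC.
have ky : g u y -> contractible g' h (f u) (f y) -> False.
  move=> guy k; have [T' c] := triple_next iu F C guy k.
  by case/negP: (nT p y T').
rewrite !(nbP Np) => ab kab /or3P[]/eqP aE /or3P[]/eqP bE; move: ab kab;
  rewrite aE bE ?g_irr ?gqy //.
- by rewrite contractible_sym.
- by move=> yu; rewrite contractible_sym // => /ky; apply; rewrite g_sym.
by rewrite g_sym gqy.
Qed.

Lemma edge_lift (u p q y w : V) (a b : V') :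
  isolated g h u -> fan g h u p q y w -> triple g h u p q ->
  contraction g g' f [set p; q] ->
  (forall p q, triple g h u p q -> ~~ ctr3 g [set u; p; q]) ->
  contractible g' h a b -> exists x y, [/\ f x = a, f y = b & contractible g h x y].
Proof.
move=> iu F T C nT kab; have [[gup guq gpq] gpy gqw p3 q3] := fan_edges F.
have [_ [c [d [ca db cd]]]] : a != b /\ exists x y, [/\ f x = a, f y = b & g x y].
  by apply: (ct_edgeP C); case/and3P: kab.
have cS : conn g [set p; q].
  apply: (@conn_root _ _ g_sym _ p) => X x clX /set2P[->//|->] qX.
  by apply: clX qX _; rewrite ?inE ?eqxx ?orbT // g_sym.
have cl x z : x \in [set p; q] -> z \in [set p; q] -> x != z -> g x z.
  by move=> /set2P[]-> /set2P[]->; rewrite ?eqxx // g_sym.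
rewrite -ca -db in kab.
case: (ct_contractible C g_sym g_irr g_con3 cS cl cd kab) => [k|[A [z [sA AS cA dA]]]].
  by exists c, d.
case/setIP => zS zN; have zA := nbh_notin zN.
have [A0 _ _] := sA.
(* One of [p], [q] is in the cut, so the side [A] is the other one alone. *)
have AE x : x \in [set p; q] -> x != z -> A = [set x].
  move=> xS xz; apply/eqP; rewrite eqEcard cards1 card_gt0 A0 andbT.
  apply/subsetP => v vA; have vz : v != z by apply: contraTneq vA => ->.
  move: xz vz; have := subsetP AS v vA; case/set2P: xS => ->; case/set2P: zS => ->;
    by case/set2P => ->; rewrite ?eqxx ?inE.
have T' := triple_sym g_sym T; have F' := fan_sym F.
have C' : contraction g g' f [set q; p] by rewrite setUC.
case/set2P: zS => zE.
  have E : A = [set q] by apply: AE;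
    rewrite ?inE ?eqxx ?orbT // zE eq_sym (edge_neq g_irr gpq).
  move: cA dA; rewrite E nbh1 // !in_nb => qc qd.
  by case: (edge_lift_pair iu F' T' C' nT cd kab qc qd).
have E : A = [set p] by apply: AE; rewrite ?inE ?eqxx ?orbT // zE (edge_neq g_irr gpq).
move: cA dA; rewrite E nbh1 // !in_nb => pc pd.
by case: (edge_lift_pair iu F T C nT cd kab pc pd).
Qed.

(** The cut consists of q, y and a third vertex s. Here q y is not an edge, and q s is one only for
    [s = w]. Contracting y s in G/upq would leave the merged triangle only [w] as a further
    neighbour. *)
Lemma triangle_lift_mid (u p q y w a b : V) : 6 < #|V| ->
  fan g h u p q y w -> contraction g g' f [set u; p; q] ->
  g a b -> contractible g' h (f a) (f b) ->
  sep3 g [set u; p] -> a \in nbh g [set u; p] -> b \in nbh g [set u; p] ->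
  a = q /\ b = w \/ a = w /\ b = q.
Proof.
move=> big F C; have [[gup guq gpq] gpy gqw p3 q3] := fan_edges F.
have [Np Nq _ u4] := F; rewrite /= !inE !negb_or -!andbA.
case/and5P => up uq uy uw /and5P[pq py pw qy /and3P[qw yw _]] ab kab sA.
have [_ _ A3] := sA.
have qN : q \in nbh g [set u; p].
  by apply: (@mem_nbh _ _ _ p); rewrite ?inE ?eqxx ?orbT // negb_or ![q == _]eq_sym uq.
have yN : y \in nbh g [set u; p].
  by apply: (@mem_nbh _ _ _ p); rewrite ?inE ?eqxx ?orbT // negb_or ![y == _]eq_sym uy.
have [s NA] := set3E A3 qN yN qy.
have sN : s \in nbh g [set u; p] by rewrite NA in3 eqxx !orbT.
have [su sp] : s != u /\ s != p by move: (nbh_notin sN); rewrite !inE negb_or => /andP[].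
have [_ qs ys] := set3_card A3 NA.
have gqy : g q y = false.
  by rewrite (nbP Nq) ![y == _]eq_sym (negPf uy) (negPf py) eq_sym (negPf yw).
have gqs : g q s -> s = w.
  by rewrite (nbP Nq) (negPf su) (negPf sp) => /eqP.
pose T := [set u; p; q].
have NT : nbh g T \subset [set y; s; w].
  apply/subsetP => z /nbhP[zT [v vT vz]]; move: zT vT; rewrite !in3 !negb_or.
  case/and3P => zu zp zq /or3P[]/eqP E; move: vz; rewrite E.
  - move=> uz; have : z \in nbh g [set u; p].
      by apply: mem_nbh uz _; rewrite !inE ?eqxx ?negb_or ?zu.
    by rewrite NA in3 (negPf zq) /= => /orP[]->; rewrite ?orbT.
  - by rewrite (nbP Np) (negPf zu) (negPf zq) /= => ->.
  by rewrite (nbP Nq) (negPf zu) (negPf zp) /= => ->; rewrite !orbT.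
have nys : contractible g' h (f y) (f s) -> False.
  case/and3P => _ _ c.
  (* The triangle and its at most three neighbours cover at most six vertices, so some vertex
     remains to be separated. *)
  have /subsetPn[x _ xN] : ~~ ([set: V] \subset T :|: [set y; s; w]).
    apply: contraL big => /subset_leq_card; rewrite cardsT -leqNgt => /leq_trans; apply.
    apply: leq_trans (leq_card_setU _ _) _; rewrite /T.
    have c3 (i j k : V) : #|[set i; j; k]| <= 3.
      by rewrite -setUA cardsU1 cards2; case: (_ \notin _); case: (_ != _).
    exact: leq_add (c3 u p q) (c3 y s w).
  move: xN; rewrite in_setU negb_or => /andP[xT xN].
  have ker := let: And4 _ k _ _ := C in k.
  have ker' v z : v \notin T -> f z = f v -> z = v.
    by move=> vT /ker[//|[_]]; rewrite -/T (negPf vT).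
  have sat v z : f v = f z -> v \in T -> z \in T by move/ker => [->|[]].
  have yT : y \notin T by rewrite in3 !negb_or ![y == _]eq_sym uy py.
  have sT : s \notin T by rewrite in3 !negb_or su sp eq_sym.
  have : 1 < #|nbh g' (f @: T) :\: [set f y; f s]|.
    apply: (@ctr3P _ _ _ _ (f x) c).
    - by apply/set0Pn; exists (f u); apply: imset_f; rewrite in3 eqxx.
    - apply/pred0P => v /=; apply/negP => /andP[/imsetP[z zT ->]].
      case/set2P => [/(ker' _ _ yT) E|/(ker' _ _ sT) E].
        by move: yT; rewrite -E zT.
      by move: sT; rewrite -E zT.
    - by apply/imsetP => -[z zT /esym E]; rewrite (sat _ _ E zT) in xT.
    - rewrite (ct_nbh C sat); apply/imsetP => -[z zN /esym /(ker' _ _ xT) E].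
      by rewrite -E (subsetP NT z zN) in xN.
    rewrite !inE negb_or; apply/andP; split; apply/eqP => /esym /(ker' _ _ xT) E;
      by rewrite -E in3 eqxx ?orbT in xN.
  rewrite (ct_nbh C sat) ltnNge => /negP; apply; rewrite -(cards1 (f w)).
  apply: subset_leq_card; apply/subsetP => v /setDP[/imsetP[z zN ->]].
  by have := subsetP NT z zN; rewrite in3 => /or3P[]/eqP->; rewrite !inE ?eqxx ?orbT.
rewrite NA !in3 => /or3P[]/eqP aE /or3P[]/eqP bE; move: ab kab;
  rewrite aE bE ?g_irr ?gqy //.
- by move=> /gqs->; left.
- by rewrite g_sym gqy.
- by rewrite g_sym => /gqs->; right.
by have g'_sym := ct_sym C g_sym; move=> _; rewrite contractible_sym // => /nys.
Qed.

(** Lifts must avoid [u], which is joined to nothing; its image is represented by [p] or [q]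
    instead. An edge that does not lift directly joins two of the images of u, y, w, and these are
    linked through p y, q w and the path y p q w. *)
Lemma triangle_lift (u p q y w : V) (a b : V') : 6 < #|V| -> isolated g h u ->
  fan g h u p q y w -> contraction g g' f [set u; p; q] -> contractible g' h a b ->
  exists c d, [/\ c != u, d != u, f c = a, f d = b & connect (contractible g h) c d].
Proof.
move=> big iu F C kab; have [[gup guq gpq] gpy gqw p3 q3] := fan_edges F.
have [Np Nq [kpq kpy kqw] u4] := F; rewrite /= !in_cons !in_nil !orbF !negb_or -!andbA.
case/and5P => up uq uy uw /and5P[pq py pw qy /and3P[qw yw _]].
have g'_sym := ct_sym C g_sym; have k_sym := contractible_sym h g_sym.
have c_sym : connect_sym (contractible g h) := sym_connect_sym k_sym.
have [ab [c [d [ca db cd]]]] : a != b /\ exists x y, [/\ f x = a, f y = b & g x y].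
  by apply: (ct_edgeP C); case/and3P: kab.
have f_T : f u = f p /\ f u = f q.
  by case: C => _ _ H _; split; apply: H; rewrite in3 eqxx ?orbT.
have [fup fuq] := f_T.
have cS : conn g [set u; p; q].
  apply: (@conn_root _ _ g_sym _ p) => X x clX; rewrite in3 => /or3P[]/eqP-> // xX.
    by apply: clX xX gup; rewrite in3 eqxx ?orbT.
  by apply: clX xX _; rewrite ?in3 ?eqxx ?orbT // g_sym.
have cl x z : x \in [set u; p; q] -> z \in [set u; p; q] -> x != z -> g x z.
  by rewrite !in3 => /or3P[]/eqP-> /or3P[]/eqP->; rewrite ?eqxx // g_sym.
rewrite -ca -db in kab.
have conn_yw : connect (contractible g h) y w.
  apply: connect_trans (connect1 _) (connect_trans (connect1 kpq) (connect1 kqw)).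
  by rewrite k_sym.
pose good (a b : V') := exists c d, [/\ c != u, d != u, f c = a,
  f d = b & connect (contractible g h) c d].
have gs i j : good i j -> good j i.
  by case=> c' [d' [H1 H2 H3 H4 H5]]; exists d', c'; split=> //; rewrite c_sym.
have fuy : good (f u) (f y) by exists p, y; split; rewrite ?connect1 // eq_sym.
have fuw : good (f u) (f w) by exists q, w; split; rewrite ?connect1 // eq_sym.
have fyw : good (f y) (f w) by exists y, w; split; rewrite // eq_sym.
rewrite -ca -db in ab *; rewrite -/(good _ _).
case: (ct_contractible C g_sym g_irr g_con3 cS cl cd kab) => [k|[A [z [sA AS cA dA]]]].
  exists c, d; split; rewrite ?connect1 //; apply: contraTneq k => ->.
    exact: (forallP iu).
  by rewrite k_sym; apply: (forallP iu).
case/setIP => zS zN; have zA := nbh_notin zN.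
(* Without [u] the side [A] lies in {p, q}, so its neighbours are in the triangle or are [y] or [w].
   With [u], it is {u, p}, {u, q}, or {u}, the last excluded by the degree of [u]. *)
have [uA|uA] := boolP (u \in A); last first.
  have NA x : x \in nbh g A -> f x = f u \/ x = y \/ x = w.
    case/nbhP => xA [v vA vx]; have := subsetP AS v vA; rewrite in3 => /or3P[]/eqP E.
    - by rewrite E in vA; rewrite vA in uA.
    - move: vx; rewrite E (nbP Np) => /or3P[]/eqP->; rewrite -?fuq; by [left | right;
      left].
    by move: vx; rewrite E (nbP Nq) => /or3P[]/eqP->; rewrite -?fup; by [left | right;
      right].
  move: ab; case: (NA c cA) => [->|[]->]; case: (NA d dA) => [->|[]->];
    rewrite ?eqxx // => _;
    by [ | apply: gs].
have [pA|pA] := boolP (p \in A); have [qA|qA] := boolP (q \in A).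
- by move: zS zA; rewrite in3 => /or3P[]/eqP->; rewrite ?uA ?pA ?qA.
- have AE : A = [set u; p].
    apply/setP => x; rewrite !inE; apply/idP/orP => [xA|[]/eqP-> //].
    have := subsetP AS x xA; rewrite in3 => /or3P[->|->|/eqP E]; [by left|by right|].
    by rewrite -E xA in qA.
  rewrite AE in sA cA dA; case: (triangle_lift_mid big F C cd kab sA cA dA) => -[-> ->].
    by rewrite -fuq.
  by rewrite -fuq; apply: gs.
- have AE : A = [set u; q].
    apply/setP => x; rewrite !inE; apply/idP/orP => [xA|[]/eqP-> //].
    have := subsetP AS x xA; rewrite in3 => /or3P[->|/eqP E|->]; [by left| |by right].
    by rewrite -E xA in pA.
  have C' : contraction g g' f [set u; q; p] by rewrite -setUA (setUC [set q]) setUA.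
  rewrite AE in sA cA dA;
    case: (triangle_lift_mid big (fan_sym F) C' cd kab sA cA dA) => -[-> ->].
    by rewrite -fup.
  by rewrite -fup; apply: gs.
have AE : A = [set u].
  apply/setP => x; rewrite !inE; apply/idP/eqP => [xA|-> //].
  have := subsetP AS x xA; rewrite in3 => /or3P[]/eqP E //.
    by rewrite -E xA in pA.
  by rewrite -E xA in qA.
by case: sA => _ _; rewrite AE nbh1 // => E; rewrite E in u4.
Qed.

End Step.

(** * The number of components *)

Section Main.
Variables (W : finType) (h : rel W).
Hypothesis h_irr : irreflexive h.
Hypothesis h_con3 : con3 h.

(** Otherwise each vertex of [U] is a whole branch set. As [U] has at least as many elements as H,
    its vertices are then all the branch sets, so G has as many vertices as H. *)
Lemma exists_safe_edge (V : finType) (g : rel V) (U : {set V}) (phi : V -> W) :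
  symmetric g -> model g h phi -> #|W| <= #|U| -> #|W| < #|V| ->
  exists u w, [/\ u \in U, g u w & safe g h [set u; w]].
Proof.
move=> g_sym M WU WV; have [surj con edges] := modelP _ _ _ M.
have [/exists_inP[u uU /existsP[w /andP[uw /eqP E]]]|none] :=
  boolP [exists u in U, exists w, g u w && (phi u == phi w)].
  exists u, w; split=> //; apply/safeP; exists phi => // x y.
  by rewrite !inE => /orP[]/eqP-> /orP[]/eqP->.
have single u x : u \in U -> phi x = phi u -> x = u.
  move=> uU xu; apply/eqP; apply: contraNT none => xnu.
  have uf : u \in fibre phi (phi u) by rewrite in_fibre.
  have xf : x \in fibre phi (phi u) by rewrite in_fibre xu.
  have [|a [b [_ bf au bu ab]]] := conn_cut (con (phi u)) uf xf (set11 u).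
    by rewrite in_set1.
  rewrite in_set1 in au; rewrite (eqP au) in ab.
  apply/exists_inP; exists u => //; apply/existsP; exists b.
  by rewrite ab /= eq_sym -in_fibre.
have inj : {in U &, injective phi} by move=> u v uU vU /(single v u vU).
have full : phi @: U = setT.
  by apply/eqP; rewrite eqEcard subsetT cardsT card_in_imset.
have VU x : x \in U.
  have : phi x \in phi @: U by rewrite full inE.
  by case/imsetP => u uU /(single u x uU) ->.
have VE : #|U| = #|V| by apply: eq_card => x; rewrite VU inE.
by move: WV; rewrite -VE -(card_in_imset inj) full cardsT ltnn.
Qed.

Lemma contractible_components n (V : finType) (g : rel V) (phi : V -> W) :
  #|V| < n -> symmetric g -> irreflexive g -> con3 g -> model g h phi ->
  #|W| < #|V| ->
  exists2 R : {set V}, dominates (contractible g h) R & 2 * #|R| + 1 <= #|V| + #|W|.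
Proof.
elim: n V g phi => // n IH V g phi Vn g_sym g_irr g_con3 M WV.
have k_sym := contractible_sym h g_sym.
have c_sym : connect_sym (contractible g h) := sym_connect_sym k_sym.
have k_irr : irreflexive (contractible g h) by move=> x; rewrite /contractible /= g_irr.
have W0 : 0 < #|W|.
  by have /card_gt0P[x _] : 0 < #|V| by [exact: leq_trans WV]; apply/card_gt0P;
    exists (phi x).
have [R domR cR] := dominating_roots k_sym k_irr.
set U := [set u | _] in cR.
have [UW|WU] := ltnP #|U| #|W|; first by exists R => //; move: cR UW; clear; lia.
have [u0 [w0 [u0U uw0 suw0]]] := exists_safe_edge g_sym M WU WV.
have tri : exists u p q, isolated g h u /\ triple g h u p q.
  rewrite inE in u0U; have iu : isolated g h u0 by [].
  by have [p [q T]] := isolated_triple g_sym g_irr g_con3 h_irr h_con3 iu uw0 suw0;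
    exists u0, p, q.
have [small|big] := leqP #|V| (#|W| + 5).
  have [u [p [q [iu T]]]] := tri.
  have [y [w F]] := triple_fan g_sym g_irr g_con3 h_irr iu T.
  have [_ _ [kpq kpy kqw] u4] := F; rewrite /= !in_cons !in_nil !orbF !negb_or -!andbA.
  case/and5P => up uq uy uw /and5P[pq py pw qy /and3P[qw yw _]].
  have c3 : #|[set y; q; w]| = 3.
    by rewrite -setUA cardsU1 cards2 !inE negb_or yw qw eq_sym qy.
  (* The path y p q w lets [p] dominate the other three vertices. *)
  exists (~: [set y; q; w]); last first.
    move: (cardsC [set y; q; w]) small; rewrite c3.
    by move: #|~: _| #|V| #|W|; clear; lia.
  move=> v; have [vS|vS] := boolP (v \in [set y; q; w]); last by exists v;
    rewrite ?inE // in vS *.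
  exists p; first by rewrite in_setC in3 !negb_or py pq pw.
  rewrite c_sym; move: vS; rewrite in3 => /or3P[]/eqP->.
  - exact: connect1.
  - exact: connect1.
  exact: connect_trans (connect1 kpq) (connect1 kqw).
(* The case distinction is made constructively by a boolean search over all triples. *)
have decT : (exists u p q, [/\ isolated g h u, triple g h u p q & ctr3 g [set u; p;
  q]]) \/
    forall u p q, isolated g h u -> triple g h u p q -> ~~ ctr3 g [set u; p; q].
  pose b u p q := [&& isolated g h u, [&& g u p, g u q & g p q], #|nb g p| == 3,
    #|nb g q| == 3 & safe g h [set u; p; q] && ctr3 g [set u; p; q]].
  have [/existsP[u /existsP[p /existsP[q]]]|H] :=
    boolP [exists u, exists p, exists q, b u p q].
    case/and5P => iu /and3P T /eqP p3 /eqP q3 /andP[s c].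
    by left; exists u, p, q.
  right=> u p q iu [[H1 H2 H3] H4 H5 H6]; apply: contra H => H7.
  apply/existsP; exists u; apply/existsP; exists p; apply/existsP; exists q.
  by rewrite /b iu H1 H2 H3 H4 H5 H6 H7.
case: decT => [[u [p [q [iu T cT]]]]|nT].
  have [y [w F]] := triple_fan g_sym g_irr g_con3 h_irr iu T.
  have [[gup guq gpq] gpy gqw p3 q3] := fan_edges g_sym F.
  have [_ _ [kpq kpy kqw] u4] := F; rewrite /= !in_cons !in_nil !orbF !negb_or -!andbA.
  case/and5P => up uq uy uw /and5P[pq py pw qy /and3P[qw yw _]].
  pose S := [set u; p; q].
  have uS : u \in S by rewrite in3 eqxx.
  have C := ct_contraction g uS.
  have [_ _ _ /safeP[psi Mpsi Cpsi]] := T.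
  have [phi' M' _] := ct_push C g_sym h_irr Mpsi Cpsi.
  have S3 : #|S| = 3 by rewrite /S -setUA cardsU1 cards2 !inE negb_or up uq pq.
  have cV := card_ct uS.
  have [V'n WV'] : #|ct_type S u| < n /\ #|W| < #|ct_type S u|.
    by move: Vn big; rewrite cV S3; move: #|V| #|W|; clear; lia.
  have [R' domR' cR'] := IH _ _ phi' V'n (ct_sym C g_sym) (ct_irr C) (ct_con3 C g_con3
    cT) M' WV'.
  (* The canonical representative of the merged vertex is [u], which dominates only itself; [p]
     replaces it and [u] is added separately. *)
  pose r (a : ct_type S u) := if a == ct_fun S u u then p else val a.
  exists (u |: r @: R').
    move=> v; have [->|vu] := eqVneq v u; first by exists u; rewrite ?setU11.
    have [a aR va] := domR' (ct_fun S u v).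
    exists (r a); first by rewrite in_setU1 imset_f ?orbT.
    have raE : ct_fun S u (r a) = a.
      rewrite /r; case: (a =P _) => [->|_]; last exact: ct_fun_val.
      by case: C => _ _ H _; apply: H; rewrite in3 eqxx ?orbT.
    have rau : r a != u.
      rewrite /r; case: (a =P _) => [_|au]; first by rewrite eq_sym.
      by apply/eqP => E; case: au; rewrite -(ct_fun_val a) E.
    apply: (@connect_lift _ _ _ (contractible (@ct_rel _ g S u) h) (ct_fun S u) (predC1
      u) _ _ v (r a)) => //; last by rewrite raE.
      move=> x z /= xu zu; case: (C) => _ ker _ _ /ker[->//|[]].
      rewrite !in3 (negPf xu) (negPf zu) /= => /orP[]/eqP-> /orP[]/eqP-> //.
        exact: connect1.
      by rewrite c_sym; apply: connect1.
    move=> b c kbc; have V6 : 6 < #|V| by move: big W0; clear; lia.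
    have [x [z [xu zu xb zc xz]]] := triangle_lift g_sym g_irr g_con3 V6 iu F C kbc.
    by exists x, z.
  (* Two vertices fewer pay exactly for the extra element [u]. *)
  have := leq_imset_card r R'; have := cardsU1 u (r @: R'); rewrite cV S3 in cR'.
  by move: cR' big; clear; case: (_ \notin _) => /=; lia.
have [u [p [q [iu T]]]] := tri.
have [y [w F]] := triple_fan g_sym g_irr g_con3 h_irr iu T.
have [[gup guq gpq] gpy gqw p3 q3] := fan_edges g_sym F.
have [_ _ [kpq kpy kqw] _ _] := F.
pose S := [set p; q].
have pS : p \in S by rewrite !inE eqxx.
have C := ct_contraction g pS.
have [_ /safeP[psi Mpsi Cpsi] cS] := and3P kpq.
have [phi' M' _] := ct_push C g_sym h_irr Mpsi Cpsi.
have S2 : #|S| = 2 by rewrite cards2 (edge_neq g_irr gpq).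
have cV := card_ct pS.
have [V'n WV'] : #|ct_type S p| < n /\ #|W| < #|ct_type S p|.
  by move: Vn big; rewrite cV S2; move: #|V| #|W|; clear; lia.
have [R' domR' cR'] := IH _ _ phi' V'n (ct_sym C g_sym) (ct_irr C) (ct_con3 C g_con3
  cS) M' WV'.
exists (val @: R').
  move=> v; have [a aR va] := domR' (ct_fun S p v).
  exists (val a); first exact: imset_f.
  apply: (@connect_lift _ _ _ (contractible (@ct_rel _ g S p) h) (ct_fun S p) predT _ _
    v (val a)) => //; last by rewrite ct_fun_val.
    move=> x z _ _; case: (C) => _ ker _ _ /ker[->//|[]].
    rewrite !inE => /orP[]/eqP-> /orP[]/eqP-> //; first exact: connect1.
    by rewrite c_sym; apply: connect1.
  move=> b c kbc; have [x [z [xb zc xz]]] := edge_lift g_sym g_irr g_con3 h_irr iu F T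
    C (fun p' q' => nT u p' q' iu) kbc.
  by exists x, z; split=> //; apply: connect1.
move: (leq_imset_card val R') cR' big; rewrite cV S2.
by move: #|val @: R'| #|R'| #|V| #|W|; clear; lia.
Qed.

End Main.

(** * Multigraphs *)

Definition joins (G : mgraph) (e : edge G) (x y : vert G) : bool :=
  (src e == x) && (tgt e == y) || (src e == y) && (tgt e == x).

Definition sgraph (G : mgraph) : rel (vert G) := [rel x y | (x != y) && adj x y].

Lemma set2_eq (T : finType) (a b c d : T) :
  ([set a; b] == [set c; d]) = (a == c) && (b == d) || (a == d) && (b == c).
Proof.
apply/eqP/idP => [E|/orP[]/andP[/eqP-> /eqP->]//]; last by rewrite setUC.
move/setP: E => E; have := E a; have := E b; have := E c; have := E d;
  rewrite {E} !inE !eqxx /= ?orbT.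
rewrite ![c == _]eq_sym ![d == _]eq_sym.
by case: (a == c); case: (b == d); case: (a == d); case: (b == c).
Qed.

Lemma ends_joins (G : mgraph) (e : edge G) (x y : vert G) :
  (ends e == [set x; y]) = joins e x y.
Proof. exact: set2_eq. Qed.

Lemma adjP (G : mgraph) (x y : vert G) :
  reflect (exists e : edge G, joins e x y) (adj x y).
Proof.
by apply: (iffP existsP) => -[e]; [rewrite ends_joins | rewrite -ends_joins]; exists e.
Qed.

Lemma joins_sym (G : mgraph) (e : edge G) (x y : vert G) : joins e x y = joins e y x.
Proof. by rewrite /joins orbC. Qed.

Lemma sgraph_sym (G : mgraph) : symmetric (@sgraph G).
Proof.
move=> x y; rewrite /sgraph /= eq_sym; congr (_ && _).
by apply: eq_existsb => e; rewrite setUC.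
Qed.

Lemma sgraph_irr (G : mgraph) : irreflexive (@sgraph G).
Proof. by move=> x; rewrite /sgraph /= eqxx. Qed.

Lemma sgraphP (G : mgraph) (x y : vert G) :
  reflect (x != y /\ exists e : edge G, joins e x y) (sgraph x y).
Proof. by apply: (iffP andP) => -[? /adjP]. Qed.

Lemma adj_del_verts (G : mgraph) (X : {set vert G}) (a b : vert (del_verts X)) :
  adj a b = adj (val a) (val b).
Proof.
apply/adjP/adjP => -[e je]; first by exists (val e).
have de : dv_edge X e.
  by rewrite /dv_edge; case/orP: je => /andP[/eqP-> /eqP->]; rewrite !(valP a, valP b).
by exists (exist _ e de).
Qed.

(** A disconnecting set of fewer than three vertices contains the neighbourhood of a component, and
    conversely a small neighbourhood separates a set from its far side. Loops and parallel edges are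
    irrelevant to both. *)
Lemma k_connected_con3 (G : mgraph) : k_connected 3 G <-> con3 (@sgraph G).
Proof.
split=> [kG A /set0Pn[a aA] /set0Pn[b bF]|cG X X3 x y].
  rewrite ltnNge; apply/negP => le2.
  have aX : a \notin nbh (@sgraph G) A by apply: contraL aA; apply: nbh_notin.
  have bX : b \notin nbh (@sgraph G) A by move: bF; rewrite in_far => /andP[].
  have := kG (nbh (@sgraph G) A) le2 (exist _ a aX) (exist _ b bX).
  set a' := exist _ a aX; set b' := exist _ b bX; case/connectP => s.
  have b'A : val b' \notin A by move: bF; rewrite in_far => /andP[].
  have a'A : val a' \in A by [].
  clearbody a' b'; elim: s a' a'A => [|c s IH] a' a'A /=.
    by move=> _ E; rewrite E a'A in b'A.
  case/andP => ac; apply: IH; rewrite adj_del_verts in ac.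
  apply: contraT => cA; case/negP: (valP c).
  apply: (mem_nbh a'A _ cA); rewrite /sgraph /= ac andbT.
  by apply: contraNneq cA => E; rewrite -[val c]/(sval c) -E.
pose A := [set val z | z in [set z | connect (@adj (del_verts X)) x z]].
have xA : val x \in A by apply: imset_f; rewrite inE connect0.
have NA : nbh (@sgraph G) A \subset X.
  apply/subsetP => v /nbhP[vA [u /imsetP[z zx ->] /andP[_ zv]]].
  apply: contraNT vA => vX; apply/imsetP; exists (exist _ v vX) => //.
  move: zx; rewrite !inE => zx; apply: connect_trans zx (connect1 _).
  by rewrite adj_del_verts.
have F0 : far (@sgraph G) A = set0.
  apply/eqP; apply: contraTT X3 => F0; rewrite -leqNgt.
  apply: leq_trans (subset_leq_card NA); apply: cG F0.
  by apply/set0Pn; exists (val x).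
have : val y \in A.
  apply: contraT => yA; have /setP/(_ (val y)) := F0; rewrite in_far yA inE /=.
  by move/negbFE/(subsetP NA) => yX; case/negP: (valP y).
by case/imsetP => z; rewrite inE => xz /val_inj ->.
Qed.

Definition ct_proj (G : mgraph) (e : edge G) (x : vert G) : vert (contract e) :=
  exist _ (ct_map e x) (ct_mapP e x).

(** Bridges the two notions of contraction. A loop fits too: its [ends] form a singleton and nothing
    is merged. *)
Lemma contract_contraction (G : mgraph) (e : edge G) :
  contraction (@sgraph G) (@sgraph (contract e)) (@ct_proj G e) (ends e).
Proof.
split.
- case=> a aP; exists a; apply: val_inj => /=; rewrite /ct_map.
  by case/orP: aP => [/eqP->|/negPf->//]; case: ifP => // /eqP.
- move=> x y /(congr1 val) /=; rewrite /ct_map !inE.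
  case: (x =P tgt e) => [->|_]; case: (y =P tgt e) => [->|_] E; first by left.
  + by right; rewrite ?eqxx ?orbT -E eqxx.
  + by right; rewrite ?eqxx ?orbT E eqxx.
  by left.
- move=> x y; rewrite !inE => xe ye; apply: val_inj => /=; rewrite /ct_map.
  by case/orP: xe => /eqP->; case/orP: ye => /eqP->; rewrite ?eqxx; do ?case: ifP.
move=> a b; split.
  case/sgraphP => ab [f jf]; split=> //; rewrite /joins /= in jf.
  case/orP: jf => /andP[/eqP sa /eqP tb].
    exists (src (val f)), (tgt (val f)); split=> //; apply/sgraphP; split.
      by apply: contraNneq ab => E; rewrite -sa -tb E.
    by exists (val f); rewrite /joins !eqxx.
  exists (tgt (val f)), (src (val f)); split=> //; apply/sgraphP; split.
    by apply: contraNneq ab => E; rewrite -sa -tb E.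
  by exists (val f); rewrite /joins !eqxx orbT.
case=> ab [x [y [xa yb /sgraphP[xy [f jf]]]]]; apply/sgraphP; split=> //.
have fe : f != e.
  apply: contra_neq ab => E; rewrite -xa -yb; apply: val_inj => /=; rewrite /ct_map.
  by case/orP: jf => /andP[/eqP<- /eqP<-]; rewrite E eqxx; do ?case: ifP.
exists (exist _ f fe); rewrite /joins -xa -yb.
by case/orP: jf => /andP[/eqP<- /eqP<-]; rewrite !eqxx ?orbT.
Qed.

Lemma ends_conn (G : mgraph) (e : edge G) : src e != tgt e -> conn (@sgraph G) (ends e).
Proof.
move=> ste; apply: (@conn_root _ _ (@sgraph_sym G) _ (src e)) =>
  X x clX /set2P[->//|->] tX.
apply: clX tX _; rewrite ?inE ?eqxx ?orbT //.
by apply/sgraphP; rewrite eq_sym; split=> //; exists e; rewrite /joins !eqxx orbT.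
Qed.

(** * From models to minors *)

Section ToMinor.
Variable H : mgraph.
Hypothesis H_simple : simple H.

Lemma card_sig_neq (T : finType) (x : T) : #|{: {y : T | y != x}}| < #|T|.
Proof.
rewrite card_sig; apply: proper_card; apply/properP; split; first exact: subset_predT.
by exists x => //; rewrite inE eqxx.
Qed.

Lemma simple_sgraph (eps : edge H) : sgraph (src eps) (tgt eps).
Proof.
have [loopless _] := H_simple; apply/sgraphP; split=> //.
by exists eps; rewrite /joins !eqxx.
Qed.

(** Contract edges inside branch sets until every branch set is a single vertex, then delete every
    edge not chosen to represent an edge of H; each operation lowers the number of edges. *)
Lemma model_has_minor (G : mgraph) (phi : vert G -> vert H) :
  model (@sgraph G) (@sgraph H) phi -> has_minor G H.
Proof.
have [n] := ubnP #|edge G|; elim: n G phi => // n IH G phi; rewrite ltnS => Gn M.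
have [surj con edges] := modelP _ _ _ M.
have [/existsP[e /andP[ste /eqP E]]|noedge] :=
  boolP [exists e : edge G, (src e != tgt e) && (phi (src e) == phi (tgt e))].
  have [|phi' M' _] := ct_push (contract_contraction e) (@sgraph_sym G) (@sgraph_irr H) M.
    by move=> x y; rewrite !inE => /orP[]/eqP-> /orP[]/eqP->.
  have En : #|edge (contract e)| < n by apply: leq_trans Gn; apply: (card_sig_neq e).
  have [N [mN iN]] := IH (contract e) phi' En M'.
  by exists N; split=> //; apply: minor_contract mN.
have inj : injective phi.
  move=> x y xy; apply/eqP; apply: contraNT noedge => xny.
  have xf : x \in fibre phi (phi x) by rewrite in_fibre.
  have yf : y \in fibre phi (phi x) by rewrite in_fibre xy.
  have [|a [b [af bf ax bx]]] := conn_cut (con (phi x)) xf yf (set11 x).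
    by rewrite in_set1 eq_sym.
  rewrite !in_fibre in af bf; case/sgraphP => ab [e je]; apply/existsP; exists e.
  by case/orP: je => /andP[/eqP-> /eqP->]; rewrite (eqP af) (eqP bf) eqxx andbT // eq_sym.
have single w : exists x, fibre phi w = [set x].
  have [x xw] := surj w; exists x; apply/setP => y; rewrite in_fibre in_set1 -xw.
  exact: inj_eq.
have [sg sgE] : exists sg : edge H -> edge G, forall eps, phi @: ends (sg eps) = ends eps.
  apply: (@fin_all_exists _ _ (fun eps e => phi @: ends e = ends eps)) => eps.
  have [x [y [xa yb /sgraphP[_ [e je]]]]] := edges _ _ (simple_sgraph eps).
  exists e; move: je; rewrite -ends_joins => /eqP->.
  by rewrite imsetU !imset_set1 xa yb.
(* Simplicity of H enters here: an edge is determined by its ends. *)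
have sg_inj : injective sg.
  have [_ ends_inj] := H_simple.
  by move=> e1 e2 E; apply: ends_inj; rewrite -!sgE E.
have [/forallP im|] := boolP [forall e, e \in codom sg].
  exists G; split; first exact: minor_refl.
  have [sg' sg'K sgK] : bijective sg.
    by apply: inj_card_bij => //; rewrite -(card_codom sg_inj); apply: subset_leq_card;
      apply/subsetP.
  exists phi, sg'; split.
  - apply: inj_card_bij => //; rewrite -cardsT -(card_codom inj).
    apply: subset_leq_card; apply/subsetP => w _; have [x <-] := surj w; exact: codom_f.
  - by exists sg.
  by move=> e; rewrite -sgE sgK.
rewrite negb_forall => /existsP[e eim].
have M' : @model (vert (edge_subgraph [set~ e])) (@sgraph (edge_subgraph [set~ e])) _
  (@sgraph H) phi.
  apply/modelP; split=> //.
    by move=> w; have [x ->] := single w; apply: conn1; apply: sgraph_sym.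
  move=> a b /sgraphP[ab [eps je]].
  have sge : sg eps \in [set~ e] by rewrite !inE; apply: contraNneq eim => <-;
    apply: codom_f.
  have E : [set phi (src (sg eps)); phi (tgt (sg eps))] == [set a; b].
    by rewrite -(eqP (_ : ends eps == [set a; b])) ?ends_joins // -sgE imsetU !imset_set1.
  have jG x y : joins (sg eps) x y -> x != y -> @sgraph (edge_subgraph [set~ e]) x y.
    by move=> jxy xy; apply/sgraphP; split=> //; exists (exist _ (sg eps) sge).
  rewrite set2_eq in E; case/orP: E => /andP[/eqP sa /eqP tb].
    exists (src (sg eps)), (tgt (sg eps)); split=> //; apply: jG;
      first by rewrite /joins !eqxx.
    by apply: contraNneq ab => E; rewrite -sa -tb E.
  exists (tgt (sg eps)), (src (sg eps)); split=> //; apply: jG;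
    first by rewrite /joins !eqxx orbT.
  by apply: contraNneq ab => E; rewrite -sa -tb E.
have En : #|edge (edge_subgraph [set~ e])| < n.
  apply: leq_trans Gn; apply: leq_trans (card_sig_neq e).
  by rewrite !card_sig ltnS; apply: subset_leq_card; apply/subsetP => f; rewrite !inE.
have [N [mN iN]] := IH (edge_subgraph [set~ e]) phi En M'.
by exists N; split=> //; apply: minor_del_edge mN.
Qed.

End ToMinor.

(** * From minors to models *)

Section PartialModels.
Variables (W : finType) (h : rel W).

(* Branch sets that need not cover the host graph. *)
Definition pmodel (V : finType) (g : rel V) (psi : V -> option W) : Prop :=
  [/\ forall w, exists x, psi x = Some w,
      forall w, conn g [set x | psi x == Some w] &
      forall a b, h a b -> exists x y, [/\ psi x = Some a, psi y = Some b & g x y]].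

Lemma conn_imset (V V' : finType) (g : rel V) (g' : rel V') (f : V' -> V) (F : {set V'}) :
  symmetric g -> (forall a b, g' a b -> g (f a) (f b)) -> conn g' F -> conn g (f @: F).
Proof.
move=> g_sym fg cF; have [->|[a0 a0F]] := set_0Vmem F.
  by rewrite imset0; apply/forall_inP => x; rewrite inE.
apply: (@conn_root _ _ g_sym _ (f a0)) => X x clX /imsetP[a aF ->] aX.
suff : a0 \in f @^-1: X by rewrite inE.
apply: (conn_closed cF _ aF a0F) => [c d cF' dF cX cd|]; last by rewrite inE.
rewrite inE in cX; rewrite inE.
exact: (clX _ _ (imset_f f cF') (imset_f f dF) cX (fg _ _ cd)).
Qed.

Lemma conn_add (V : finType) (g : rel V) (F : {set V}) (a v : V) :
  symmetric g -> conn g F -> a \in F -> g a v -> conn g (v |: F).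
Proof.
move=> g_sym cF aF av; apply: (@conn_root _ _ g_sym _ a) => X x clX /setU1P[->|xF] xX.
  by apply: clX xX _; rewrite ?setU11 ?setU1r // g_sym.
apply: (conn_closed cF _ xF aF xX) => c d cF' dF; apply: clX; exact: setU1r.
Qed.

(** By connectedness some uncovered vertex is adjacent to a covered one and can join its branch set.
    Nonemptiness of [W] provides a covered vertex to start from. *)
Lemma pmodel_total (V : finType) (g : rel V) (psi : V -> option W) :
  symmetric g -> con3 g -> 0 < #|W| -> irreflexive h ->
  pmodel g psi -> exists phi, model g h phi.
Proof.
move=> g_sym g_con3 /card_gt0P[w0 _] h_irr.
have [n] := ubnP #|[set x | psi x == None]|.
elim: n psi => // n IH psi; rewrite ltnS => psin [surj con edges].
have [E|n0] := eqVneq [set x | psi x == None] set0.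
  have psiE x : psi x = Some (odflt w0 (psi x)).
    by move/setP/(_ x): E; rewrite !inE; case: (psi x).
  exists (fun x => odflt w0 (psi x)); apply/modelP; split.
  - by move=> w; have [x xw] := surj w; exists x; rewrite xw.
  - move=> w; suff -> : fibre (fun x =>
    odflt w0 (psi x)) w = [set x | psi x == Some w] by [].
    by apply/setP => x; rewrite !inE [in RHS]psiE.
  by move=> a b /edges[x [y [xa yb xy]]]; exists x, y; rewrite xa yb.
set A := [set x | psi x != None].
have AN x : (x \in A) = (psi x != None) by rewrite inE.
have [v vN] : exists v, v \in nbh g A.
  have [F0|F0] := eqVneq (far g A) set0; last first.
    have : 2 < #|nbh g A|.
      apply: g_con3 => //; have [x xw] := surj w0.
      by apply/set0Pn; exists x; rewrite inE xw.
    by move=> N3; apply/card_gt0P; apply: leq_trans N3.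
  case/set0Pn: n0 => v; rewrite inE => vnone; exists v.
  move/setP/(_ v): F0; rewrite in_far AN vnone in_set0.
  by move/negbFE.
case/nbhP: vN; rewrite AN negbK => /eqP vnone [a]; rewrite AN.
case aw: (psi a) => [w|//] _ av.
pose psi' x := if x == v then Some w else psi x.
have psi'E x : x != v -> psi' x = psi x by rewrite /psi' => /negPf->.
have ne x c : psi x = Some c -> x != v by move=> E; apply: contra_eq_neq E => ->;
  rewrite vnone.
apply: (IH psi').
  apply: leq_trans psin; apply: proper_card; apply/properP; split.
    by apply/subsetP => x; rewrite !inE /psi'; case: (x =P v).
  by exists v; rewrite !inE ?vnone // /psi' eqxx.
split.
- by move=> c; have [x xc] := surj c; exists x; rewrite psi'E // (ne x c).
- move=> c; have [->|cw] := eqVneq c w.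
    have -> : [set x | psi' x == Some w] = v |: [set x | psi x == Some w].
      apply/setP => x; rewrite !inE /psi'; case: (x =P v) => [_|_] //=.
      by rewrite eqxx.
    by apply: conn_add av; rewrite // inE aw.
  have -> : [set x | psi' x == Some c] = [set x | psi x == Some c] => //.
  apply/setP => x; rewrite !inE /psi'; case: (x =P v) => [->|_] //.
  by rewrite vnone; apply/eqP => -[E]; rewrite E eqxx in cw.
move=> c d /edges[x [y [xc yd xy]]]; exists x, y.
by rewrite !psi'E ?(ne x c) ?(ne y d).
Qed.

End PartialModels.

(** Models are pulled back through each minor operation; partial ones are needed because a deleted
    vertex belongs to no branch set. *)
Lemma minor_pmodel (M G H : mgraph) : simple H -> minor M G -> iso M H ->
  exists psi, pmodel (@sgraph H) (@sgraph G) psi.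
Proof.
move=> H_simple; elim=> {G} [|G x _ IH|G e _ IH|G e _ IH] iM.
- have [fv [fe [bv be E]]] := iM; have [fv' fvK fv'K] := bv; have [fe' feK fe'K] := be.
  exists (Some \o fv); split.
  + by move=> w; exists (fv' w); rewrite /= fv'K.
  + move=> w; suff -> : [set x | (Some \o fv) x == Some w] = [set fv' w].
      by apply: conn1; apply: sgraph_sym.
    by apply/setP => x; rewrite !inE /=; apply/eqP/eqP => [[<-]|->]; rewrite ?fvK ?fv'K.
  move=> a b /sgraphP[ab [eps]]; rewrite -ends_joins -(fe'K eps) E => /eqP je.
  exists (fv' a), (fv' b); rewrite /= !fv'K; split=> //; apply/sgraphP; split.
    by apply: contra_neq ab => ab'; rewrite -(fv'K a) ab' fv'K.
  exists (fe' eps); rewrite -ends_joins; apply/eqP/(imset_inj (can_inj fvK)).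
  by rewrite je imsetU !imset_set1 !fv'K.
- have [psi [surj con edges]] := IH iM.
  pose D := del_verts [set x].
  pose psi' v := if @insub _ _ (vert D) v is Some z then psi z else None.
  have psiE (z : vert D) : psi' (val z) = psi z by rewrite /psi' valK.
  have gE (y z : vert D) : sgraph y z -> sgraph (val y) (val z).
    rewrite /sgraph /= adj_del_verts => /andP[yz ->]; rewrite andbT.
    by apply: contra_neq yz; apply: val_inj.
  exists psi'; split.
  + by move=> w; have [z zw] := surj w; exists (val z); rewrite psiE.
  + move=> w; suff -> : [set v | psi' v == Some w] = val @: [set z | psi z == Some w].
      exact: (conn_imset (@sgraph_sym G) gE (con w)).
    apply/setP => v; rewrite inE; apply/idP/imsetP => [|[z]]; last first.
      by rewrite inE => zw ->; rewrite psiE.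
    by rewrite /psi'; case: insubP => [z _ <- zw|//]; exists z; rewrite ?inE.
  by move=> a b /edges[y [z [ya zb yz]]]; exists (val y), (val z); rewrite !psiE;
    split=> //; apply: gE.
- have [psi [surj con edges]] := IH iM.
  have gE (y z : vert G) : @sgraph (edge_subgraph [set~ e]) y z -> @sgraph G y z.
    by case/sgraphP => yz [f jf]; apply/sgraphP; split=> //; exists (val f).
  exists psi; split=> //.
    move=> w; have := conn_imset (@sgraph_sym G) gE (con w).
    by rewrite imset_id.
  by move=> a b /edges[y [z [ya zb yz]]]; exists y, z; split=> //; apply: gE.
have [psi [surj con edges]] := IH iM.
have C := contract_contraction e.
have cS : conn (@sgraph G) (ends e).
  have [E|ste] := eqVneq (src e) (tgt e); last exact: ends_conn.
  by rewrite /ends E setUid; apply: conn1; apply: sgraph_sym.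
exists (psi \o @ct_proj G e); split.
- move=> w; have [a aw] := surj w; case: (C) => fs _ _ _; have [y ya] := fs a.
  by exists y; rewrite /= ya.
- move=> w; suff -> : [set y | (psi \o @ct_proj G e) y == Some w] = @ct_proj G e @^-1:
  [set a | psi a == Some w].
    exact: (ct_conn C (@sgraph_sym G) cS (con w)).
  by apply/setP => y; rewrite !inE.
move=> a b /edges[y [z [ya zb yz]]].
have [_ [y' [z' [yy zz yz']]]] := ct_edgeP C yz.
by exists y', z'; rewrite /= yy zz.
Qed.

(** * Forests in multigraphs *)

Section Forests.
Variable G : mgraph.

Definition eadj (F : {set edge G}) : rel (vert G) :=
  [rel x y | [exists e in F, joins e x y]].

Lemma eadj_sym F : symmetric (eadj F).
Proof. by move=> x y; apply: eq_existsb => e; rewrite joins_sym. Qed.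

Lemma eadj_csym F : connect_sym (eadj F).
Proof. exact/sym_connect_sym/eadj_sym. Qed.

Lemma eadjS (E F : {set edge G}) x y :
  E \subset F -> connect (eadj E) x y -> connect (eadj F) x y.
Proof.
move=> EF; apply: connect_sub => a b /exists_inP[e eE ab]; apply: connect1.
by apply/exists_inP; exists e => //; apply: (subsetP EF).
Qed.

(** Every edge is a bridge. This also forbids loops, whose ends are trivially connected, and
    parallel edges. *)
Definition acyclic (F : {set edge G}) : Prop :=
  forall e, e \in F -> ~~ connect (eadj (F :\ e)) (src e) (tgt e).

Lemma acyclicS (E F : {set edge G}) : E \subset F -> acyclic F -> acyclic E.
Proof.
by move=> EF aF e eE; apply: contra (aF e (subsetP EF e eE)); apply: eadjS; apply: setSD.
Qed.

Lemma chain_connect (E : {set edge G}) (s : seq (vert G)) (es : seq (edge G)) (a b :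
  vert G) :
  {subset es <= E} ->
  map (@ends G) es = [seq [set p.1; p.2] | p <- zip (a :: s) (rcons s b)] ->
  connect (eadj E) a b.
Proof.
elim: s a es => [|c s IH] a [|e es] //= sub [] /eqP; rewrite ends_joins => je E'.
  by apply/connect1/exists_inP; exists e => //; apply: sub; rewrite mem_head.
apply: (@connect_trans _ _ c).
  by apply/connect1/exists_inP; exists e => //; apply: sub; rewrite mem_head.
by apply: IH E' => f fes; apply: sub; rewrite in_cons fes orbT.
Qed.

(** The rest of a cycle connects the ends of its first edge. *)
Lemma acyclic_forest (F : {set edge G}) : acyclic F -> forest (edge_subgraph F).
Proof.
move=> aF [|v vs] es [] // _ _; rewrite rot1_cons.
case: es => [|e es]; first by case: vs.
rewrite [uniq _]/= => /andP[ees _].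
have sub : {subset map val es <= F :\ val e}.
  move=> _ /mapP[f fes ->]; rewrite in_setD1 (valP f) andbT.
  by apply: contraNneq ees => /val_inj <-.
have em : map (@ends (edge_subgraph F)) es = map (@ends G) (map val es) by rewrite
  -map_comp.
have nc := aF (val e) (valP e).
have J x y : @ends (edge_subgraph F) e = [set x; y] ->
    connect (eadj (F :\ val e)) y x -> False.
  move=> /eqP; rewrite (@ends_joins G (val e)) => /orP[]/andP[/eqP sx /eqP ty] c;
    case/negP: nc; rewrite sx ty //.
  by rewrite eadj_csym.
case: vs => [|c s] /=.
  by case=> /J; rewrite connect0 => /(_ isT).
case=> /J H; rewrite em => E'; apply: H.
exact: chain_connect sub E'.
Qed.

(** Deleting an edge is compensated by adding at most one vertex to [R]; without edges, [R] is
    everything. *)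
Lemma dominating_edges (F : {set edge G}) (R : {set vert G}) :
  dominates (eadj F) R -> #|vert G| <= #|F| + #|R|.
Proof.
have [n] := ubnP #|F|; elim: n F R => // n IH F R; rewrite ltnS => Fn dom.
have [F0|[e eF]] := set_0Vmem F.
  rewrite F0 cards0 add0n; apply: subset_leq_card; apply/subsetP => v _.
  have [r rR] := dom v; rewrite F0 => /connectP[[|x s] /= ]; first by move=> _ <-.
  by case/andP => /exists_inP[f]; rewrite inE.
set E := F :\ e.
have cE : #|F| = #|E|.+1 by rewrite (cardsD1 e) eF.
have FE a b : eadj F a b -> eadj E a b \/ joins e a b.
  case/exists_inP => f fF jf; have [<-|fe] := eqVneq f e; first by right.
  by left; apply/exists_inP; exists f; rewrite // in_setD1 fe.
pose reach (S : {set vert G}) := [set v | [exists s in S, connect (eadj E) v s]].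
have in_reach S v : (v \in reach S) = [exists s in S,
  connect (eadj E) v s] by rewrite inE.
have reachS (S : {set vert G}) : {subset S <= reach S}.
  by move=> s sS; rewrite in_reach; apply/exists_inP; exists s; rewrite ?connect0.
have full (S : {set vert G}) : R \subset reach S -> (forall a b, joins e a b ->
  a \in reach S -> b \in reach S) ->
    forall v, v \in reach S.
  move=> RS eS v; have clS a b : eadj F a b -> a \in reach S -> b \in reach S.
    case/FE => [ab|/eS //]; rewrite !in_reach => /exists_inP[s sS as'].
    apply/exists_inP; exists s => //; apply: connect_trans as'.
    by apply: connect1; rewrite eadj_sym.
  have [r rR vr] := dom v.
  rewrite (@closed_connect _ (eadj F) (mem (reach S)) _ _ _ vr);
    first exact: (subsetP RS).
  by move=> a b ab; apply/idP/idP; apply: clS; rewrite // eadj_sym.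
have step x z : x \in reach R -> joins e x z -> #|vert G| <= #|F| + #|R|.
  move=> xR jxz; have sub : {subset reach R <= reach (z |: R)}.
    move=> v; rewrite !in_reach => /exists_inP[r rR vr]; apply/exists_inP.
    by exists r; rewrite // setU1r.
  have : #|vert G| <= #|E| + #|z |: R|.
    apply: IH => [|v]; first by rewrite -cE.
    suff : v \in reach (z |: R) by rewrite in_reach => /exists_inP[s]; exists s.
    apply: full => [|a b jab _]; first by apply/subsetP => r rR; apply: reachS;
      rewrite setU1r.
    have [->|->] : b = x \/ b = z; last 2 first.
    - exact: sub.
    - by apply: reachS; rewrite setU11.
    case/orP: jxz => /andP[/eqP<- /eqP<-]; case/orP: jab => /andP[/eqP E1 /eqP E2];
      by [left; rewrite -?E1 -?E2 | right; rewrite -?E1 -?E2].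
  by rewrite cE cardsU1 => H; apply: leq_trans H _; case: (_ \notin _);
    rewrite /= ?add0n ?add1n ?addSn ?addnS // ltnW.
have [sR|sR] := boolP (src e \in reach R).
  by apply: (step _ (tgt e) sR); rewrite /joins !eqxx.
have [tR|tR] := boolP (tgt e \in reach R).
  by apply: (step _ (src e) tR); rewrite /joins !eqxx orbT.
(* If neither end of [e] is reached, what [R] reaches without [e] is closed under all of [F], hence
   everything. *)
suff : src e \in reach R by rewrite (negPf sR).
apply: full => [|a b]; first by apply/subsetP; apply: reachS.
by case/orP => /andP[/eqP<- /eqP<-]; rewrite ?(negPf sR) ?(negPf tR).
Qed.

(** Take a minimal subset that still connects the ends of every edge of [S]; an edge lying on a
    cycle could be dropped. *)
Lemma spanning_forest (S : {set edge G}) :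
  exists F : {set edge G}, [/\ F \subset S, acyclic F &
    forall e, e \in S -> connect (eadj F) (src e) (tgt e)].
Proof.
pose P (F : {set edge G}) := [forall e in S, connect (eadj F) (src e) (tgt e)].
have PS : P S.
  apply/forall_inP => e eS; apply/connect1/exists_inP; exists e => //.
  by rewrite /joins !eqxx.
have [F /minsetP[PF minF] FS] := minset_exists PS.
exists F; split=> //; last by move=> e eS; apply: (forall_inP PF).
move=> e eF; apply/negP => ce; have := minF (F :\ e) _ (subsetDl _ _).
suff -> : P (F :\ e) by move=> /(_ isT) E; move: eF; rewrite -E setD11.
apply/forall_inP => f fS; have := forall_inP PF f fS; apply: connect_sub => a b.
case/exists_inP => e' e'F jab; have [E|ne] := eqVneq e' e; last first.
  by apply/connect1/exists_inP; exists e'; rewrite // in_setD1 ne.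
rewrite E in jab; case/orP: jab => /andP[/eqP<- /eqP<-] //.
by rewrite eadj_csym.
Qed.

(** A spanning forest has at least [k] edges; surplus ones are discarded, since subsets of forests
    are forests. *)
Lemma forest_of_size (S : {set edge G}) (R : {set vert G}) (k : nat) :
  dominates (eadj S) R -> k + #|R| <= #|vert G| ->
  exists F : {set edge G}, [/\ F \subset S, forest (edge_subgraph F) & #|F| = k].
Proof.
move=> dom kR; have [F [FS aF span]] := spanning_forest S.
have domF : dominates (eadj F) R.
  move=> v; have [r rR vr] := dom v; exists r => //; apply: connect_sub vr => a b.
  case/exists_inP => e eS /orP[]/andP[/eqP<- /eqP<-]; first exact: span.
  by rewrite eadj_csym; apply: span.
have := dominating_edges domF => le; have kF : k <= #|F|.
  by rewrite -(leq_add2r #|R|); apply: leq_trans le.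
exists [set x in take k (enum F)]; split.
- by apply: subset_trans FS; apply/subsetP => x; rewrite inE => /mem_take;
  rewrite mem_enum.
- apply/acyclic_forest/(acyclicS _ aF); apply/subsetP => x.
  by rewrite inE => /mem_take; rewrite mem_enum.
rewrite cardsE; have /card_uniqP -> : uniq (take k (enum F)) by apply/take_uniq/enum_uniq.
by rewrite size_takel // -cardE.
Qed.

End Forests.

(** Both conditions on the order of H exclude false instances. For |H| = |G| one edge would be
    required, but contracting a non-loop leaves fewer than |H| vertices; for empty H and G a single
    vertex, one forest edge would be required. *)
Theorem theorem2 (G H : mgraph)
    (G_3conn : k_connected 3 G)
    (H_3conn : k_connected 3 H)
    (H_simple : simple H)
    (H_minor : has_minor G H)
    (H_nonempty : 0 < #|vert H|)
    (H_smaller : #|vert H| < #|vert G|) :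
  exists F : {set edge G},
    [/\ forest (edge_subgraph F),
        #|F| = uphalf (#|vert G| - #|vert H| + 1) &
        forall e : edge G, e \in F -> H_contractible H e].
Proof.
have g_con3 := (k_connected_con3 G).1 G_3conn.
have h_con3 := (k_connected_con3 H).1 H_3conn.
have g_sym := @sgraph_sym G.
have g_irr := @sgraph_irr G; have h_irr := @sgraph_irr H.
have [M [mM iM]] := H_minor.
have [psi pM] := minor_pmodel H_simple mM iM.
have [phi modM] := pmodel_total g_sym g_con3 H_nonempty h_irr pM.
have [R domR cR] := contractible_components h_irr h_con3 (ltnSn _) g_sym g_irr g_con3
  modM H_smaller.
pose S := [set e : edge G | contractible (@sgraph G) (@sgraph H) (src e) (tgt e)].
have [||F [FS fF cF]] := @forest_of_size G S R (uphalf (#|vert G| - #|vert H| + 1)).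
- move=> v; have [r rR vr] := domR v; exists r => //; apply: connect_sub vr => a b kab.
  have [/sgraphP[_ [e jab]] _ _] := and3P kab.
  apply/connect1/exists_inP; exists e => //; rewrite inE.
  by case/orP: jab => /andP[/eqP-> /eqP->] //; rewrite contractible_sym.
(* From 2|R| + 1 <= |G| + |H| one gets |G| - |R| >= (|G| - |H| + 1)/2, and integrality allows
   rounding up. *)
- by move: H_smaller cR; move: #|R| #|vert G| #|vert H|; clear; lia.
exists F; split=> // e /(subsetP FS); rewrite inE => /and3P[se sfe cce].
have [ste _] := sgraphP _ _ se.
have C := contract_contraction e.
have [chi modchi chiC] := safeP _ _ _ sfe.
have [phi' M' _] := ct_push C g_sym h_irr modchi chiC.
split; last exact: (model_has_minor H_simple M').
by apply/k_connected_con3; apply: (ct_con3 C).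
Qed.
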